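(* Let $d\in\{1,2,3,\dots\}$. There exists a constant $C=C(d)>0$, depending only on $d$, such that for every bounded open set $U\subset\mathbb{R}^d$ one can find a covering $$U\subset\bigcup_{i=0}^\infty B_{r_i}(x_i)$$ by open balls of radii $r_i$ (the covering not depending on $\alpha$) for which $$\sum_{i=0}^\infty r_i^{d-\alpha}\le C\,\alpha(1-\alpha)\,P_\alpha(U)\qquad\text{for every }\alpha\in(0,1).$$
   Context: For a Lebesgue measurable set $A\subset\mathbb{R}^d$ and $\alpha\in(0,1)$, the fractional perimeter is $$P_\alpha(A):=2\int_A\int_{\mathbb{R}^d\setminus A}\frac{dy\,dz}{|y-z|^{\alpha+d}}\in[0,+\infty].$$ $B_r(x)$ denotes the open ball of radius $r$ centered at $x$. Coverings are countable families of balls; finite families are allowed. *)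

(* Defs.v *)
From HB Require Import structures.
From mathcomp Require Import all_boot all_order all_algebra.
From mathcomp Require Import all_classical all_reals all_analysis.

Set Implicit Arguments.
Unset Strict Implicit.
Unset Printing Implicit Defensive.
Import Order.TTheory GRing.Theory Num.Theory.
Import numFieldNormedType.Exports.

Local Open Scope classical_set_scope.
Local Open Scope ring_scope.

(* Matrices carry the sigma-algebra generated by their entries; on row vectors
   of reals it is the Borel one (see open_measurable_rV). *)
Definition measure_matrix_display : measure_display -> measure_display.
Proof. exact. Qed.

Section measurable_matrix.
Context (d : measure_display) (T : measurableType d) (m n : nat).

Definition entry_preimages : set (set 'M[T]_(m, n)) :=
  \bigcup_(ij in [set: 'I_m * 'I_n])
    preimage_set_system setT (fun M : 'M[T]_(m, n) => M ij.1 ij.2) measurable.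

Let matrix_set0 : <<s entry_preimages >> set0.
Proof. exact: sigma_algebra0. Qed.

Let matrix_setC A : <<s entry_preimages >> A -> <<s entry_preimages >> (~` A).
Proof. exact: sigma_algebraC. Qed.

Let matrix_bigcup (F : (set 'M[T]_(m, n))^nat) :
  (forall i, <<s entry_preimages >> (F i)) ->
  <<s entry_preimages >> (\bigcup_i F i).
Proof. exact: sigma_algebra_bigcup. Qed.

HB.instance Definition _ := @isMeasurable.Build (measure_matrix_display d)
  'M[T]_(m, n) <<s entry_preimages >> matrix_set0 matrix_setC matrix_bigcup.

Lemma measurable_entry (i : 'I_m) (j : 'I_n) :
  measurable_fun [set: 'M[T]_(m, n)] (fun M : 'M[T]_(m, n) => M i j).
Proof.
move=> _ B mB; apply: sub_sigma_algebra.
by exists (i, j) => //; exists B.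
Qed.

Lemma measurable_fun_matrix (d' : measure_display) (S : measurableType d')
    (f : S -> 'M[T]_(m, n)) :
  (forall i j, measurable_fun [set: S] (fun s => f s i j)) ->
  measurable_fun [set: S] f.
Proof.
move=> mf; apply: (@measurability _ _ _ _ _ f entry_preimages) => //.
move=> _ [_ [[i j] _ [B mB <-]] <-].
by rewrite setTI; exact: mf.
Qed.

End measurable_matrix.

Section lebesgue_measure_rV.
Context {R : realType}.
Local Open Scope ereal_scope.

Definition row_cons (n : nat) (p : measurableTypeR R * 'rV[R]_n) : 'rV[R]_n.+1 :=
  row_mx (p.1 : R)%:M p.2.

Definition row_uncons (n : nat) (v : 'rV[R]_n.+1) : measurableTypeR R * 'rV[R]_n :=
  (v 0%R 0%R, @rsubmx _ 1 1 n v).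

Lemma row_consK (n : nat) : cancel (@row_cons n) (@row_uncons n).
Proof.
move=> [x v]; rewrite /row_cons /row_uncons row_mxKr.
apply: (congr1 (fun y : measurableTypeR R => (y, v))).
have e0 : (0%R : 'I_n.+1) = lshift n (0%R : 'I_1) by exact/val_inj.
rewrite [in LHS]e0; apply: etrans (row_mxEl _ _ _ _) _.
by rewrite mxE eqxx.
Qed.

Lemma row_unconsK (n : nat) : cancel (@row_uncons n) (@row_cons n).
Proof.
move=> v; apply: etrans (@hsubmxK _ 1 1 n v).
apply: (congr1 (fun x : 'M[R]_1 => row_mx x (rsubmx (v : 'rV[R]_(1 + n))))).
apply/rowP => i; rewrite !ord1 !mxE eqxx mulr1n.
by congr (v _ _); exact/val_inj.
Qed.

Lemma measurable_row_cons (n : nat) : measurable_fun setT (@row_cons n).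
Proof.
apply: measurable_fun_matrix => i j.
have [k jk|k jk] := @splitP 1 n j.
  rewrite (_ : (fun _ => _) = @fst (measurableTypeR R) 'rV[R]_n).
    exact: (@measurable_fst _ _ (measurableTypeR R) 'rV[R]_n).
  apply/funext => p; have -> : j = lshift n k by exact/val_inj.
  by apply: etrans (row_mxEl _ _ _ _) _; rewrite !ord1 mxE eqxx.
rewrite (_ : (fun _ => _) =
    (fun M : 'rV[R]_n => M i k) \o @snd (measurableTypeR R) 'rV[R]_n).
  by apply: measurableT_comp; [exact: measurable_entry|exact: measurable_snd].
apply/funext => p; have -> : j = rshift 1 k by exact/val_inj.
exact: row_mxEr.
Qed.

Lemma measurable_row_uncons (n : nat) : measurable_fun setT (@row_uncons n).
Proof.
apply: measurable_fun_pair; first exact: measurable_entry.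
apply: measurable_fun_matrix => i j.
under eq_fun do rewrite mxE.
exact: measurable_entry.
Qed.

Definition lebesgue_measure_cons (n : nat) (mu : set 'rV[R]_n -> \bar R) :
    set 'rV[R]_n.+1 -> \bar R :=
  pushforward (lebesgue_measure \x mu) (@row_cons n).

Section lebesgue_measure_cons.
Context (n : nat) (mu : {sigma_finite_measure set 'rV[R]_n -> \bar R}).

Let lebesgue_measure_cons0 : lebesgue_measure_cons mu set0 = 0.
Proof. by rewrite /lebesgue_measure_cons /pushforward preimage_set0 measure0. Qed.

Let lebesgue_measure_cons_ge0 A : 0 <= lebesgue_measure_cons mu A.
Proof. by rewrite /lebesgue_measure_cons /pushforward measure_ge0. Qed.

Let lebesgue_measure_cons_semi_sigma_additive :
  semi_sigma_additive (lebesgue_measure_cons mu).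
Proof.
move=> F mF tF mUF.
pose nu := measure_function_pushforward__canonical__measure_function_Measure
  (lebesgue_measure \x mu) (@measurable_row_cons n).
exact: (@measure_semi_sigma_additive _ _ _ nu).
Qed.

HB.instance Definition _ := isMeasure.Build _ _ _ (lebesgue_measure_cons mu)
  lebesgue_measure_cons0 lebesgue_measure_cons_ge0
  lebesgue_measure_cons_semi_sigma_additive.

Let lebesgue_measure_cons_sigma_finite :
  sigma_finite setT (lebesgue_measure_cons mu).
Proof.
have /sigma_finiteP[F [FT ndF Foo]] := sigma_finiteT (@lebesgue_measure R).
have /sigma_finiteP[G [GT ndG Goo]] := sigma_finiteT mu.
exists (fun k => @row_uncons n @^-1` (F k `*` G k)).
  apply/esym; rewrite -subTset => v _.
  have : [set: measurableTypeR R] (row_uncons v).1 by [].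
  have : [set: 'rV[R]_n] (row_uncons v).2 by [].
  rewrite FT GT => -[k _ Gkv] [l _ Flv]; exists (maxn k l) => //; split.
  - by move: Flv; exact/subsetPset/ndF/leq_maxr.
  - by move: Gkv; exact/subsetPset/ndG/leq_maxl.
move=> k; have [mF Fkoo] := Foo k; have [mG Gkoo] := Goo k; split.
  rewrite -[X in measurable X]setTI; apply: measurable_row_uncons => //.
  exact: measurableX.
rewrite /lebesgue_measure_cons /pushforward -comp_preimage.
rewrite (_ : _ \o _ = idfun); last by apply/funext => p; exact: row_consK.
by rewrite preimage_id product_measure1E// lte_mul_pinfty// ge0_fin_numE.
Qed.

HB.instance Definition _ := @Measure_isSigmaFinite.Build _ _ _
  (lebesgue_measure_cons mu) lebesgue_measure_cons_sigma_finite.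

End lebesgue_measure_cons.

(* The n-fold product of the one-dimensional Lebesgue measure, characterized on
   boxes by lebesgue_measure_rV_box and on points of 'rV_0 as a unit mass. *)
Fixpoint lebesgue_measure_rV (n : nat) : set 'rV[R]_n -> \bar R :=
  if n is n'.+1 then lebesgue_measure_cons (@lebesgue_measure_rV n')
  else \d_ (0%R : 'rV[R]_0).
Arguments lebesgue_measure_rV n _ : clear implicits.

Let lebesgue_measure_rVE (n : nat) :
  exists mu : {sigma_finite_measure set 'rV[R]_n -> \bar R},
    lebesgue_measure_rV n = mu :> (set 'rV[R]_n -> \bar R).
Proof.
elim: n => [|n [mu muE]]; first by exists (\d_ (0%R : 'rV[R]_0)).
by exists (lebesgue_measure_cons mu); rewrite /= muE.
Qed.

Section lebesgue_measure_rV_instance.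
Context (n : nat).

Let lebesgue_measure_rV0 : lebesgue_measure_rV n set0 = 0.
Proof. by have [mu ->] := lebesgue_measure_rVE n; exact: measure0. Qed.

Let lebesgue_measure_rV_ge0 A : 0 <= lebesgue_measure_rV n A.
Proof. by have [mu ->] := lebesgue_measure_rVE n; exact: measure_ge0. Qed.

Let lebesgue_measure_rV_semi_sigma_additive :
  semi_sigma_additive (lebesgue_measure_rV n).
Proof.
by have [mu ->] := lebesgue_measure_rVE n; exact: measure_semi_sigma_additive.
Qed.

HB.instance Definition _ := isMeasure.Build _ _ _ (lebesgue_measure_rV n)
  lebesgue_measure_rV0 lebesgue_measure_rV_ge0
  lebesgue_measure_rV_semi_sigma_additive.

Let lebesgue_measure_rV_sigma_finite :
  sigma_finite setT (lebesgue_measure_rV n).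
Proof. by have [mu ->] := lebesgue_measure_rVE n; exact: sigma_finiteT. Qed.

HB.instance Definition _ := @Measure_isSigmaFinite.Build _ _ _
  (lebesgue_measure_rV n) lebesgue_measure_rV_sigma_finite.

End lebesgue_measure_rV_instance.

End lebesgue_measure_rV.
Arguments lebesgue_measure_rV {R} n _.
Lemma open_measurable_rV (R : realType) (n : nat) (U : set 'rV[R]_n) :
  open U -> measurable U.
Proof.
move=> oU.
pose box (q : 'rV[rat]_n) (k : nat) : set 'rV[R]_n :=
  [set v | forall i : 'I_n, ball (ratr (q 0 i) : R) k.+1%:R^-1 (v 0 i)].
have mbox q k : measurable (box q k).
  rewrite (_ : box q k = \bigcap_(i in [set: 'I_n])
      ((fun v : 'rV[R]_n => v 0 i) @^-1` ball (ratr (q 0 i) : R) k.+1%:R^-1)).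
    apply: fin_bigcap_measurable => // i _.
    rewrite -[X in measurable X]setTI; apply: measurable_entry => //.
    exact: measurable_realfun.measurable_ball.
  by apply/seteqP; split => v /= vq i; [move=> _; exact: vq|exact: vq].
have -> : U = \bigcup_(qk : 'rV[rat]_n * nat)
    (if `[< box qk.1 qk.2 `<=` U >] then box qk.1 qk.2 else set0).
  apply/seteqP; split => [v Uv|v [qk _]]; last by case: asboolP => // sub; exact: sub.
  have /nbhs_ballP[e /= e0 veU] : nbhs v U by exact: open_nbhs_nbhs.
  have [k ke] : exists k : nat, k.+1%:R^-1 *+ 2 < e.
    have e20 : 0 < e / 2 by rewrite divr_gt0.
    have [k] := ltr_add_invr e20; rewrite add0r ltr_pdivlMr// mulr_natr => ke.
    by exists k.
  have k0 : 0 < k.+1%:R^-1 :> R by rewrite invr_gt0.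
  have /choice[q qv] : forall i, exists q : rat,
      ball (ratr q : R) k.+1%:R^-1 (v 0 i).
    move=> i; have : v 0 i - k.+1%:R^-1 < v 0 i + k.+1%:R^-1.
      by rewrite ltrBlDr -addrA ltrDl addr_gt0.
    move=> /rat_in_itvoo[q]; rewrite in_itv/= => /andP[q1 q2]; exists q.
    by rewrite /ball/= ltr_distl q1 q2.
  exists (\row_i q i, k) => //=; case: asboolP => [_ i|]; first by rewrite mxE.
  case=> w wq; apply: veU; split=> // i j; rewrite ord1.
  apply: (@le_ball _ _ _ (k.+1%:R^-1 + k.+1%:R^-1)).
    by rewrite -mulr2n ltW.
  apply: ball_triangle; first exact: (ball_sym (qv j)).
  by have := wq j; rewrite mxE.
apply: countable_bigcupT_measurable => // qk.
by case: asboolP => // _; exact: measurable0.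
Qed.

Lemma row_cons0 (R : realType) n (x : R) (v : 'rV[R]_n) : row_cons (x, v) 0 0 = x.
Proof. exact: (congr1 fst (row_consK (x, v))). Qed.

Lemma row_consS (R : realType) n (x : R) (v : 'rV[R]_n) i :
  row_cons (x, v) 0 (lift ord0 i) = v 0 i.
Proof.
have /rowP/(_ i) := congr1 snd (row_consK (x, v)).
by rewrite mxE => <-; congr (row_cons _ _ _); exact/val_inj.
Qed.

Lemma lebesgue_measure_rV_box (R : realType) (n : nat) (A : 'I_n -> set R) :
  (forall i, measurable (A i)) ->
  lebesgue_measure_rV n [set v | forall i, A i (v 0 i)] =
  (\prod_(i < n) lebesgue_measure (A i))%E.
Proof.
elim: n A => [|n ih] A mA.
  by rewrite big_ord0 /= diracE mem_set//= => -[].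
rewrite big_ord_recl /= /lebesgue_measure_cons /pushforward.
rewrite -ih//.
have mB : measurable [set v : 'rV[R]_n | forall i, A (lift ord0 i) (v 0 i)].
  rewrite (_ : mkset _ = \bigcap_(i in [set: 'I_n])
      ((fun v : 'rV[R]_n => v 0 i) @^-1` A (lift ord0 i))).
    apply: fin_bigcap_measurable => // i _.
    by rewrite -[X in measurable X]setTI; exact: measurable_entry.
  by apply/seteqP; split => v /= vA i; [move=> _; exact: vA|exact: vA].
rewrite -product_measure1E//.
apply: (congr1 (product_measure1 _ _)).
apply/seteqP; split => [[x v] /= H|[x v] /= [H1 H2] i]; first split => [|i].
- by have := H ord0; rewrite row_cons0.
- by have := H (lift ord0 i); rewrite row_consS.
- by have [j|] := unliftP ord0 i => ->; rewrite ?row_consS ?row_cons0.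
exact: mA.
Qed.

Section euclidean.
Context {R : realType} {n : nat}.
Implicit Types (x y : 'rV[R]_n) (A : set 'rV[R]_n).

(* The library norm on 'rV[R]_n is the maximum norm; it gives the same open and
   bounded sets as the Euclidean one but not the same balls. *)
Definition eucl_norm x : R := Num.sqrt (\sum_(i < n) x 0 i ^+ 2).

Definition eucl_ball x (r : R) : set 'rV[R]_n := [set y | eucl_norm (y - x) < r].

(* Integrals are taken against the Borel restriction of the Lebesgue measure.
   The integral of a nonnegative function is a supremum over simple functions
   below it, so it is unchanged by completing the sigma-algebra when the
   function is Lebesgue measurable. *)
Definition frac_perimeter (alpha : R) A : \bar R :=
  (2%:E * \int[lebesgue_measure_rV n]_(y in A)
            \int[lebesgue_measure_rV n]_(z in ~` A)
              ((eucl_norm (y - z) `^ (alpha + n%:R))^-1)%:E)%E.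

End euclidean.

(* Main.v *)
Require Import Defs.
From mathcomp Require Import all_boot all_order all_algebra.
From mathcomp Require Import all_classical all_reals all_analysis.
From mathcomp Require Import measurable_realfun ring lra zify.
Import Order.TTheory GRing.Theory Num.Theory.
Import numFieldNormedType.Exports.

Set Implicit Arguments.
Unset Strict Implicit.
Unset Printing Implicit Defensive.

Local Open Scope classical_set_scope.
Local Open Scope ring_scope.

(** The covering consists of the maximal dyadic cubes in which U has density at
least 2^-(d+1), each replaced by a ball containing it. They exist because U is
open (small cubes lie in U) and bounded (large cubes contain little of it),
they are pairwise disjoint because dyadic cubes are nested or disjoint, and
none of this involves alpha. Disjointness reduces the theorem to one cube Q of
side s, where the bound to prove is

  c s^(d - alpha) <= alpha (1 - alpha) times
                     the integral over U & Q and then over ~ U of the kernel.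

By maximality, U has density less than 2^-(d+1) in every dyadic ancestor of Q,
hence at most 1/2 in Q itself. Two regimes give the two factors.

For alpha <= 1/2 the complement of U far from Q matters. Between consecutive
ancestors it fills a fixed proportion of the volume, so each of the first
1/alpha dyadic annuli around Q contributes at least a constant times
s^(- alpha) to the integral of the kernel over ~ U (annuli_integral_ge,
far_integral_ge).

For alpha >= 1/2 the pairs inside Q matter. Let J(rho) be the energy of the
pairs (y, z) in (U & Q) x (Q - U) at distance at most rho. The midpoint of such
a pair lies in U & Q or in Q - U, so it forms with one of the two endpoints
a pair at half the distance; changing variables gives
J(rho) <= 2^(1 - alpha) J(rho / 2) (close_energy_half). Iterating k times, all
but the fraction k (1 - alpha) of the energy is carried by the pairs at
distance at most rho / 2^k (close_energy_gap). With rho the diameter of Q and k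
depending only on d, the pairs at distance more than rho / 2^k still have
measure comparable to s^(2 d), so their energy is at least a constant times
s^(d - alpha), and the full energy is larger by a factor 1 / (1 - alpha)
(near_energy_ge).

The two regimes are combined in stopping_cube_energy_ge. *)

(** * Midpoint change of variables *)

Section integral_midpoint.
Context {R : realType}.
Local Open Scope ereal_scope.
Local Notation lambda := (@lebesgue_measure R).

(** Typed on the measurable space carrying [lebesgue_measure], so that the map
    can be used as the argument of a pushforward. *)
Definition midpointR (b x : measurableTypeR R) : measurableTypeR R :=
  (2^-1 * ((b : R) + (x : R)))%R.

Definition midpoint n (y z : 'rV[R]_n) : 'rV[R]_n := (2^-1 *: (y + z))%R.

Lemma midpointC n (y z : 'rV[R]_n) : midpoint y z = midpoint z y.
Proof. by rewrite /midpoint addrC. Qed.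

Lemma measurable_midpointR (b : R) :
  measurable_fun [set: measurableTypeR R] (midpointR b).
Proof.
apply: measurable_funM => //; exact: measurable_funD.
Qed.

Lemma preimage_midpointR (b u v : R) :
  (midpointR b) @^-1` `]u, v] = `](2 * u - b)%R, (2 * v - b)%R]%classic.
Proof.
apply/seteqP; split => x /=; rewrite !in_itv /= /midpointR;
  move=> /andP[h1 h2]; apply/andP; split; lra.
Qed.

(** By uniqueness of Lebesgue measure: half the pushforward of [lambda] along the
    midpoint map gives every interval ]u, v] its length. *)
Lemma lebesgue_measure_midpointR (b : R) (A : set (measurableTypeR R)) :
  measurable A -> lambda ((midpointR b) @^-1` A) = 2%:E * lambda A.
Proof.
move=> mA.
have half0 : (0 <= 2^-1 :> R)%R by [].
pose nu : {measure set (measurableTypeR R) -> \bar R} := mscale (NngNum half0)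
  (measure_function_pushforward__canonical__measure_function_Measure
     lambda (measurable_midpointR b)).
have nuE B : nu B = (2^-1)%:E * lambda (midpointR b @^-1` B) by [].
have -> : lambda A = nu A.
  apply: (lebesgue_measure_unique (mu := nu)) => // _ [[u v] _ <-].
  apply: etrans; last exact/esym/nuE.
  rewrite [in RHS]preimage_midpointR !lebesgue_measure_itv /= !lte_fin.
  have -> : (2 * u - b < 2 * v - b)%R = (u < v)%R by apply/idP/idP => h; lra.
  case: ifP => _; rewrite ?mule0// -!EFinD -EFinM; congr EFin; lra.
by rewrite nuE muleA -EFinM divff// mul1e.
Qed.

Lemma integral_midpointR (b : R) (f : measurableTypeR R -> \bar R) :
  measurable_fun setT f -> (forall x, 0 <= f x) ->
  \int[lambda]_x f (midpointR b x) = 2%:E * \int[lambda]_x f x.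
Proof.
move=> mf f0.
have -> : \int[lambda]_x f (midpointR b x) =
    \int[pushforward lambda (midpointR b)]_x f x.
  by rewrite (ge0_integral_pushforward (measurable_midpointR b)).
have two0 : (0 <= 2 :> R)%R by [].
rewrite -(ge0_integral_mscale lambda measurableT (NngNum two0))//.
apply: eq_measure_integral => [|mphi A mA _]; first exact: measurable_midpointR.
exact: (lebesgue_measure_midpointR b mA).
Qed.

Lemma measurable_midpoint n (b : 'rV[R]_n) :
  measurable_fun [set: 'rV[R]_n] (midpoint b).
Proof.
apply: measurable_fun_matrix => i j.
rewrite (_ : (fun _ => _) =
   (midpointR (b i j)) \o (fun v : 'rV[R]_n => v i j)); last first.
  by apply/funext => v; rewrite /midpoint /midpointR /= !mxE.
apply: measurableT_comp; first exact: measurable_midpointR.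
exact: measurable_entry.
Qed.

Lemma midpoint_row_cons n a (b : 'rV[R]_n) x v :
  midpoint (row_cons (a, b)) (row_cons (x, v)) =
  row_cons (midpointR a x, midpoint b v).
Proof.
apply/rowP => i; case: (unliftP ord0 i) => [j|] ->; 
    rewrite [LHS]mxE [X in (_ * X)%R]mxE; last by rewrite !row_cons0.
  by rewrite !row_consS !mxE.
Qed.

(** The recursive definition of the measure, read as an iterated integral. *)
Lemma integral_lebesgue_measure_rVS n (f : 'rV[R]_n.+1 -> \bar R) :
  measurable_fun setT f -> (forall x, 0 <= f x) ->
  \int[lebesgue_measure_rV n.+1]_v f v =
  \int[lambda]_x \int[lebesgue_measure_rV n]_v f (row_cons (x, v)).
Proof.
move=> mf f0.
transitivity (\int[lambda \x lebesgue_measure_rV n]_p f (row_cons p)).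
  transitivity (\int[pushforward (lambda \x lebesgue_measure_rV n)
      (@row_cons R n)]_v f v).
    by rewrite [in LHS]/lebesgue_measure_rV.
  rewrite (ge0_integral_pushforward (@measurable_row_cons R n) _ measurableT mf)//.
rewrite fubini_tonelli1//.
apply: measurableT_comp => //; exact: measurable_row_cons.
Qed.

(** The map [midpoint b] is a homothety of ratio 1/2; the factor 2 of the
    one-dimensional case is collected once per coordinate. *)
Lemma integral_midpoint n (b : 'rV[R]_n) (f : 'rV[R]_n -> \bar R) :
  measurable_fun setT f -> (forall x, 0 <= f x) ->
  \int[lebesgue_measure_rV n]_v f (midpoint b v) =
  (2 ^+ n)%:E * \int[lebesgue_measure_rV n]_v f v.
Proof.
elim: n b f => [|n ih] b f mf f0.
  rewrite mul1e; apply: eq_integral => v _; congr f; apply/rowP; by case.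
rewrite -(row_unconsK b); case: (row_uncons b) => a {}b.
rewrite !integral_lebesgue_measure_rVS//; last first.
  apply: measurableT_comp => //; exact: measurable_midpoint.
have mfc : measurable_fun setT (f \o @row_cons R n).
  apply: measurableT_comp => //; exact: measurable_row_cons.
pose F (x : measurableTypeR R) := \int[lebesgue_measure_rV n]_v f (row_cons (x, v)).
have F0 x : 0 <= F x by exact: integral_ge0.
have mF : measurable_fun setT F.
  exact: (measurable_fun_fubini_tonelli_F (m2 := lebesgue_measure_rV n)
    (f \o @row_cons R n) mfc (fun p => f0 _)).
transitivity (\int[lambda]_x ((2 ^+ n)%:E * F (midpointR a x))).
  apply: eq_integral => x _; under eq_integral do rewrite midpoint_row_cons.
  rewrite (ih _ (fun v => f (row_cons (midpointR a x, v))))//.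
  apply: measurableT_comp => //.
  apply: measurableT_comp; first exact: measurable_row_cons.
  exact: measurable_pair1.
have mFa : measurable_fun setT (F \o midpointR a).
  by apply: measurableT_comp mF _; exact: measurable_midpointR.
have k0 : (0 <= 2 ^+ n :> R)%R by rewrite exprn_ge0.
have Z := ge0_integralZl_EFin lambda measurableT (fun x _ => F0 (midpointR a x)) mFa k0.
apply: (etrans Z); apply: (etrans (congr1 _ (integral_midpointR a mF F0))).
have E2 : (2 ^+ n)%:E * 2%:E = (2 ^+ n.+1)%:E :> \bar R by rewrite -EFinM -exprSr.
exact: (etrans (muleA _ _ _) (congr1 (mule^~ _) E2)).
Qed.

End integral_midpoint.

(** * The Euclidean norm and the fractional kernel *)

Section eucl_norm.
Context {R : realType} {n : nat}.
Implicit Types (x y z : 'rV[R]_n) (m alpha : R).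

Lemma eucl_norm_ge0 x : 0 <= eucl_norm x.
Proof. exact: sqrtr_ge0. Qed.

Lemma eucl_normZ (c : R) x : eucl_norm (c *: x) = `|c| * eucl_norm x.
Proof.
rewrite /eucl_norm -sqrtr_sqr -sqrtrM ?sqr_ge0// mulr_sumr.
by congr Num.sqrt; apply: eq_bigr => i _; rewrite mxE exprMn.
Qed.

Lemma normr_le_eucl_norm x i : `|x 0 i| <= eucl_norm x.
Proof.
rewrite -sqrtr_sqr /eucl_norm ler_sqrt ?sumr_ge0// => [|j _]; last exact: sqr_ge0.
by rewrite (bigD1 i)//= lerDl sumr_ge0// => j _; exact: sqr_ge0.
Qed.

(** The constant n in place of the optimal square root of n keeps the later
    constants free of roots. *)
Lemma eucl_norm_le x m : 0 <= m -> (forall i, `|x 0 i| <= m) ->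
  eucl_norm x <= n%:R * m.
Proof.
move=> m0 xm; rewrite -[leRHS]ger0_norm ?mulr_ge0// -sqrtr_sqr /eucl_norm.
rewrite ler_sqrt ?sqr_ge0//.
apply: (@le_trans _ _ (\sum_(i < n) m ^+ 2)).
  apply: ler_sum => i _; rewrite -[leLHS]real_normK ?num_real//.
  by rewrite lerXn2r// nnegrE.
rewrite sumr_const card_ord exprMn -[leLHS]mulr_natl ler_wpM2r ?sqr_ge0//.
by rewrite -natrX ler_nat; case: (n) => // k; rewrite -mulnn leq_pmulr.
Qed.

Lemma eucl_norm_eq0 x : eucl_norm x = 0 -> x = 0.
Proof.
move=> x0; apply/rowP => i; rewrite mxE; apply/eqP.
by rewrite -normr_le0 -x0 normr_le_eucl_norm.
Qed.

Lemma measurable_eucl_dist :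
  measurable_fun [set: 'rV[R]_n * 'rV[R]_n] (fun p => eucl_norm (p.1 - p.2)).
Proof.
apply: (@measurableT_comp _ _ _ _ _ _ (@Num.sqrt R)).
  apply: continuous_measurable_fun; exact: sqrt_continuous.
apply: measurable_sum => i; apply: measurable_funX.
rewrite (_ : (fun _ => _) = (fun p : 'rV[R]_n * 'rV[R]_n => p.1 0 i - p.2 0 i)).
  apply: measurable_funB.
    apply: (@measurableT_comp _ _ _ _ _ _ (fun M : 'rV[R]_n => M 0 i)).
      exact: measurable_entry.
    exact: measurable_fst.
  apply: (@measurableT_comp _ _ _ _ _ _ (fun M : 'rV[R]_n => M 0 i)).
    exact: measurable_entry.
  exact: measurable_snd.
by apply/funext => p; rewrite !mxE.
Qed.

(** As a function on the product space, so that Tonelli applies; at (y, z) it is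
    convertible to the integrand of [frac_perimeter]. *)
Definition frac_kernel alpha (p : 'rV[R]_n * 'rV[R]_n) : \bar R :=
  ((eucl_norm (p.1 - p.2) `^ (alpha + n%:R))^-1)%:E.

Lemma frac_kernelE alpha p :
  frac_kernel alpha p = (eucl_norm (p.1 - p.2) `^ (- (alpha + n%:R)))%:E.
Proof. by rewrite /frac_kernel powRN. Qed.

Lemma frac_kernel_ge0 alpha p : (0 <= frac_kernel alpha p)%E.
Proof. by rewrite frac_kernelE lee_fin powR_ge0. Qed.

Lemma measurable_frac_kernel alpha : measurable_fun setT (frac_kernel alpha).
Proof.
rewrite (_ : frac_kernel alpha =
  EFin \o (fun p => eucl_norm (p.1 - p.2) `^ (- (alpha + n%:R)))); last first.
  by apply/funext => p; rewrite frac_kernelE.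
apply: measurableT_comp => //.
apply: (@measurableT_comp _ _ _ _ _ _ (@powR R ^~ (- (alpha + n%:R)))).
  exact: measurable_powR.
exact: measurable_eucl_dist.
Qed.

(** The hypothesis [y <> z] is needed because inverse and power are totalized:
    on the diagonal the kernel takes the value 0. *)
Lemma frac_kernel_ge alpha m y z : 0 < alpha -> y <> z ->
  eucl_norm (y - z) <= m ->
  ((m `^ (- (alpha + n%:R)))%:E <= frac_kernel alpha (y, z))%E.
Proof.
move=> a0 yz yzm; rewrite frac_kernelE lee_fin /=.
have d0 : 0 < eucl_norm (y - z).
  rewrite lt_neqAle eucl_norm_ge0 andbT eq_sym; apply/eqP => /eucl_norm_eq0.
  by move/eqP; rewrite subr_eq0 => /eqP.
rewrite !powRN lef_pV2 ?posrE ?powR_gt0//; last exact: lt_le_trans yzm.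
have e0 : 0 <= alpha + n%:R by rewrite addr_ge0// ltW.
apply: ge0_ler_powR => //; rewrite nnegrE ?eucl_norm_ge0//.
by apply: le_trans yzm; exact: eucl_norm_ge0.
Qed.

Lemma sub_midpoint y z : y - midpoint y z = 2^-1 *: (y - z).
Proof. by apply/rowP => i; rewrite !mxE; field. Qed.

Lemma midpoint_sub y z : midpoint y z - z = 2^-1 *: (y - z).
Proof. by apply/rowP => i; rewrite !mxE; field. Qed.

Lemma eucl_norm_half x : eucl_norm (2^-1 *: x) = eucl_norm x / 2.
Proof. by rewrite eucl_normZ ger0_norm// mulrC. Qed.

Lemma powR_half_dist alpha x :
  (eucl_norm x `^ (- (alpha + n%:R)) =
  2 `^ (- (alpha + n%:R)) * (eucl_norm x / 2) `^ (- (alpha + n%:R))).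
Proof. by rewrite -powRM ?divr_ge0 ?eucl_norm_ge0// mulrC mulfVK. Qed.

Lemma frac_kernel_midpointl alpha y z : frac_kernel alpha (y, z) =
  ((2 `^ (- (alpha + n%:R)))%:E * frac_kernel alpha (y, midpoint y z))%E.
Proof.
by rewrite !frac_kernelE /= sub_midpoint eucl_norm_half -EFinM -powR_half_dist.
Qed.

Lemma frac_kernel_midpointr alpha y z : frac_kernel alpha (y, z) =
  ((2 `^ (- (alpha + n%:R)))%:E * frac_kernel alpha (midpoint y z, z))%E.
Proof.
by rewrite !frac_kernelE /= midpoint_sub eucl_norm_half -EFinM -powR_half_dist.
Qed.

End eucl_norm.

(** * Energy of close pairs and the midpoint inequality *)

Section close_pairs.
Context {R : realType} {n : nat}.
Local Open Scope ereal_scope.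
Local Notation mu := (@lebesgue_measure_rV R n).
Implicit Types (E F : set 'rV[R]_n) (rho : R).

Definition close_pairs E F rho : set ('rV[R]_n * 'rV[R]_n) :=
  [set p | [/\ E p.1, F p.2 & (eucl_norm (p.1 - p.2) <= rho)%R]].

Definition close_energy alpha E F rho :=
  \int[mu \x mu]_(p in close_pairs E F rho) frac_kernel alpha p.

Lemma measurable_close_pairs E F rho : measurable E -> measurable F ->
  measurable (close_pairs E F rho).
Proof.
move=> mE mF.
rewrite (_ : close_pairs E F rho = (E `*` F) `&`
  (setT `&` [set p | eucl_norm (p.1 - p.2) <= rho]%R)).
  apply: measurableI; first exact: measurableX.
  apply: measurable_fun_le => //; exact: measurable_eucl_dist.
by apply/seteqP; split => -[y z] /= [] => [Ey Fz yz|[Ey Fz] [_ yz]].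
Qed.

Lemma measurable_midpoint_snd : measurable_fun setT
  (fun p : 'rV[R]_n * 'rV[R]_n => (p.1, midpoint p.1 p.2)).
Proof.
apply: measurable_fun_pair; first exact: measurable_fst.
apply: measurable_fun_matrix => i j.
rewrite (_ : (fun _ => _) =
    (fun p : 'rV[R]_n * 'rV[R]_n => 2^-1 * (p.1 i j + p.2 i j))%R).
  apply: measurable_funM => //; apply: measurable_funD.
    apply: (@measurableT_comp _ _ _ _ _ _ (fun M : 'rV[R]_n => M i j)).
      exact: measurable_entry.
    exact: measurable_fst.
  apply: (@measurableT_comp _ _ _ _ _ _ (fun M : 'rV[R]_n => M i j)).
    exact: measurable_entry.
  exact: measurable_snd.
by apply/funext => p; rewrite !mxE.
Qed.

Lemma measurable_midpoint_fst : measurable_fun setT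
  (fun p : 'rV[R]_n * 'rV[R]_n => (midpoint p.1 p.2, p.2)).
Proof.
apply: measurable_fun_pair; last exact: measurable_snd.
exact: (measurableT_comp (@measurable_snd _ _ 'rV[R]_n 'rV[R]_n)
  measurable_midpoint_snd).
Qed.

Lemma integral_midpoint_snd (g : 'rV[R]_n * 'rV[R]_n -> \bar R) :
  measurable_fun setT g -> (forall p, 0 <= g p) ->
  \int[mu \x mu]_p g (p.1, midpoint p.1 p.2) = (2 ^+ n)%:E * \int[mu \x mu]_p g p.
Proof.
move=> mg g0.
pose G y := \int[mu]_z g (y, z).
have mG : measurable_fun setT G := measurable_fun_fubini_tonelli_F (m2 := mu) g mg g0.
have G0 y : 0 <= G y by exact: integral_ge0.
have k0 : (0 <= 2 ^+ n :> R)%R by rewrite exprn_ge0.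
have mgm : measurable_fun setT
    (fun p : 'rV[R]_n * 'rV[R]_n => g (p.1, midpoint p.1 p.2)).
  exact: (measurableT_comp mg measurable_midpoint_snd).
apply: (etrans (fubini_tonelli1 (m1 := mu) (m2 := mu) _ mgm (fun p => g0 _))).
transitivity (\int[mu]_y ((2 ^+ n)%:E * G y)).
  apply: eq_integral => y _; apply: (integral_midpoint y (f := fun z => g (y, z))) => //.
  apply: measurableT_comp => //; exact: measurable_pair1.
apply: (etrans (ge0_integralZl_EFin mu measurableT (fun y _ => G0 y) mG k0)).
by congr (_ * _); apply/esym; exact: (fubini_tonelli1 (m1 := mu) (m2 := mu) _ mg g0).
Qed.

Lemma integral_midpoint_fst (g : 'rV[R]_n * 'rV[R]_n -> \bar R) :
  measurable_fun setT g -> (forall p, 0 <= g p) ->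
  \int[mu \x mu]_p g (midpoint p.1 p.2, p.2) = (2 ^+ n)%:E * \int[mu \x mu]_p g p.
Proof.
move=> mg g0.
pose G z := \int[mu]_y g (y, z).
have mG : measurable_fun setT G := measurable_fun_fubini_tonelli_G (m1 := mu) g mg g0.
have G0 y : 0 <= G y by exact: integral_ge0.
have k0 : (0 <= 2 ^+ n :> R)%R by rewrite exprn_ge0.
have mgm : measurable_fun setT
    (fun p : 'rV[R]_n * 'rV[R]_n => g (midpoint p.1 p.2, p.2)).
  exact: (measurableT_comp mg measurable_midpoint_fst).
apply: (etrans (fubini_tonelli2 (m1 := mu) (m2 := mu) _ mgm (fun p => g0 _))).
transitivity (\int[mu]_y ((2 ^+ n)%:E * G y)).
  apply: eq_integral => z _; rewrite /fubini_G /=.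
  under eq_integral do rewrite midpointC.
  apply: (integral_midpoint z (f := fun y => g (y, z))) => //.
  apply: measurableT_comp => //; exact: measurable_pair2.
apply: (etrans (ge0_integralZl_EFin mu measurableT (fun y _ => G0 y) mG k0)).
by congr (_ * _); apply/esym; exact: (fubini_tonelli2 (m1 := mu) (m2 := mu) _ mg g0).
Qed.

Section energy.
Variables (alpha : R) (E F : set 'rV[R]_n).
Hypotheses (mE : measurable E) (mF : measurable F).
Hypothesis midEF : forall y z, E y -> F z ->
  E (midpoint y z) \/ F (midpoint y z).

Lemma close_energy_ge0 rho : 0 <= close_energy alpha E F rho.
Proof. by apply: integral_ge0 => p _; exact: frac_kernel_ge0. Qed.

(** The midpoint m of a pair (y, z) is in E or in F, so (m, z) or (y, m) is again
    a pair, at half the distance, and its kernel is 2^(alpha + n) times larger.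
    Each of the two substitutions costs a Jacobian 2^n, whence the factor
    2 * 2^n * 2^(- alpha - n) = 2^(1 - alpha). *)
Lemma close_energy_half rho :
  close_energy alpha E F rho <=
  (2 `^ (1 - alpha))%:E * close_energy alpha E F (rho / 2).
Proof.
pose S r := close_pairs E F r.
pose g := frac_kernel alpha \_ (S (rho / 2)%R).
pose c : R := (2 `^ (- (alpha + n%:R)))%R.
have c0 : (0 <= c)%R by exact: powR_ge0.
have mS r : measurable (S r) by exact: measurable_close_pairs.
have mg : measurable_fun setT g.
  apply: (iffLR (measurable_restrictT _ (mS _))).
  apply: measurable_funTS; exact: measurable_frac_kernel.
have g0 p : 0 <= g p by rewrite /g patchE; case: ifP => // _; exact: frac_kernel_ge0.
have m1 := measurableT_comp mg measurable_midpoint_snd.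
have m2 := measurableT_comp mg measurable_midpoint_fst.
have m12 := emeasurable_funD m1 m2.
have Jg : close_energy alpha E F (rho / 2) = \int[mu \x mu]_p g p.
  exact: integral_mkcond.
have ptw p : S rho p -> frac_kernel alpha p <=
    c%:E * (g (p.1, midpoint p.1 p.2) + g (midpoint p.1 p.2, p.2)).
  case: p => y z [/= Ey Fz yz].
  have yz2 : (eucl_norm (2^-1 *: (y - z)) <= rho / 2)%R.
    by rewrite eucl_norm_half ler_pM2r.
  have [Em|Fm] := midEF Ey Fz.
    rewrite (frac_kernel_midpointr _ y z); apply: lee_wpmul2l; first by rewrite lee_fin.
    rewrite [X in _ <= _ + X](_ : _ = frac_kernel alpha (midpoint y z, z)).
      by rewrite leeDr.
    by rewrite /g patchE mem_set//; split => //=; rewrite midpoint_sub.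
  rewrite (frac_kernel_midpointl _ y z); apply: lee_wpmul2l; first by rewrite lee_fin.
  rewrite [X in _ <= X + _](_ : _ = frac_kernel alpha (y, midpoint y z)).
    by rewrite leeDl.
  by rewrite /g patchE mem_set//; split => //=; rewrite sub_midpoint.
have mfr (D : set ('rV[R]_n * 'rV[R]_n)) (f : _ -> \bar R) :
  measurable_fun setT f -> measurable_fun D f.
  exact: (measurable_funS measurableT (@subsetT _ _)).
pose h (p : 'rV[R]_n * 'rV[R]_n) :=
  g (p.1, midpoint p.1 p.2) + g (midpoint p.1 p.2, p.2).
have h0 p : 0 <= h p by rewrite adde_ge0.
have mch : measurable_fun setT (fun p => c%:E * h p).
  exact: measurable_funeM.
have le1 : close_energy alpha E F rho <= \int[mu \x mu]_(p in S rho) (c%:E * h p).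
  apply: ge0_le_integral => //; first by move=> p _; exact: frac_kernel_ge0.
  - exact: mfr (measurable_frac_kernel alpha).
  - exact: mfr mch.
apply: (le_trans le1).
have le2 : \int[mu \x mu]_(p in S rho) (c%:E * h p) <= \int[mu \x mu]_p (c%:E * h p).
  apply: ge0_subset_integral => // p _; apply: mule_ge0 => //; by rewrite lee_fin.
apply: (le_trans le2).
have e1 := ge0_integralZl_EFin (mu \x mu) measurableT (fun p _ => h0 p) m12 c0.
have e2 := ge0_integralD (mu \x mu) measurableT (fun p _ => g0 (p.1, midpoint p.1 p.2)) m1
   (fun p _ => g0 (midpoint p.1 p.2, p.2)) m2.
have e3 := congr2 adde (integral_midpoint_snd mg g0) (integral_midpoint_fst mg g0).
have key J : 0 <= J ->
    c%:E * ((2 ^+ n)%:E * J + (2 ^+ n)%:E * J) = (2 `^ (1 - alpha))%:E * J.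
  move=> J0; rewrite -ge0_muleDl ?lee_fin ?exprn_ge0// muleA -EFinD -EFinM.
  suff -> : (c * (2 ^+ n + 2 ^+ n) = 2 `^ (1 - alpha))%R by [].
  have -> : (2 ^+ n + 2 ^+ n = 2 ^+ n.+1 :> R)%R by rewrite exprS mulr_natl mulr2n.
  rewrite -powR_mulrn// /c -powRD; last by apply/implyP.
  by congr (_ `^ _)%R; rewrite -natr1; ring.
rewrite Jg (etrans e1 (etrans (congr1 (mule _) (etrans e2 e3)) (key _ _)))//.
exact: integral_ge0.
Qed.

Lemma close_energy_iter_half rho k :
  (2 `^ (- (k%:R * (1 - alpha))))%:E * close_energy alpha E F rho <=
  close_energy alpha E F (rho / 2 ^+ k).
Proof.
elim: k => [|k ih]; first by rewrite mul0r oppr0 powRr0 mul1e expr0 divr1.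
have := close_energy_half (rho / 2 ^+ k).
have -> : (rho / 2 ^+ k / 2 = rho / 2 ^+ k.+1)%R by rewrite exprSr invfM mulrA.
move: ih; move: (close_energy _ _ _ (_ / 2 ^+ k)) => J1.
move: (close_energy _ _ _ (_ / 2 ^+ k.+1)) (close_energy _ _ _ _) => J2 J0 J01 J12.
have c0 : (0 <= 2 `^ (- (1 - alpha)) :> R)%R by exact: powR_ge0.
have -> : (2 `^ (- (k.+1%:R * (1 - alpha))) =
    2 `^ (- (1 - alpha)) * 2 `^ (- (k%:R * (1 - alpha))) :> R)%R.
  rewrite -powRD; last by apply/implyP.
  by congr (_ `^ _)%R; rewrite -natr1; ring.
rewrite EFinM -muleA; apply: (@le_trans _ _ ((2 `^ (- (1 - alpha)))%:E * J1)).
  by apply: lee_wpmul2l => //; rewrite lee_fin.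
apply: (le_trans (lee_wpmul2l _ J12)); first by rewrite lee_fin.
rewrite muleA -EFinM -powRD; last by apply/implyP.
by rewrite addNr powRr0 mul1e.
Qed.

End energy.
End close_pairs.

(** * Lower bound for the energy inside a convex set *)

(** 2^(- t) = exp (- t ln 2) and ln 2 <= 1. *)
Lemma sub1_le_powR2N (R : realType) (t : R) : 0 <= t -> 1 - t <= 2 `^ (- t).
Proof.
move=> t0; rewrite /powR pnatr_eq0 /=; apply: le_trans (expR_ge1Dx _).
rewrite mulNr lerD2l lerN2 -[leRHS]mulr1 ler_wpM2l//.
have h : (-1 < 1 :> R) by lra.
exact: (le_ln1Dx h).
Qed.

Lemma ge0_integral_setX d1 d2 (T1 : measurableType d1) (T2 : measurableType d2)
    (R : realType) (m1 : {sigma_finite_measure set T1 -> \bar R})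
    (m2 : {sigma_finite_measure set T2 -> \bar R})
    (A : set T1) (B : set T2) (f : T1 * T2 -> \bar R) :
  measurable A -> measurable B -> measurable_fun setT f ->
  (forall p, 0 <= f p)%E ->
  (\int[m1 \x m2]_(p in A `*` B) f p =
   \int[m1]_(y in A) \int[m2]_(z in B) f (y, z))%E.
Proof.
move=> mA mB mf f0.
have mAB : measurable (A `*` B) by exact: measurableX.
rewrite integral_mkcond [RHS]integral_mkcond.
have m' : measurable_fun setT (f \_ (A `*` B)).
  apply: (iffLR (measurable_restrictT _ mAB)).
  exact: measurable_funTS.
have f'0 p : (0 <= (f \_ (A `*` B)) p)%E by rewrite patchE; case: ifP.
apply: (etrans (fubini_tonelli1 (m1 := m1) (m2 := m2) _ m' f'0)).
apply: eq_integral => y _; rewrite /fubini_F patchE.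
case: ifPn => [yA|yA].
  rewrite [RHS]integral_mkcond; apply: eq_integral => z _.
  by rewrite !patchE in_setX yA.
apply: integral0_eq => z _.
by rewrite !patchE in_setX (negbTE yA).
Qed.

Section gap.
Context {R : realType} {n : nat}.
Local Open Scope ereal_scope.
Local Notation mu := (@lebesgue_measure_rV R n).
Variables (alpha : R) (E F : set 'rV[R]_n).
Hypotheses (alpha_gt0 : (0 < alpha)%R) (mE : measurable E) (mF : measurable F).

Let mfk (D : set ('rV[R]_n * 'rV[R]_n)) : measurable_fun D (frac_kernel alpha).
Proof. by apply: measurable_funTS; exact: measurable_frac_kernel. Qed.

(** Since the pairs at distance at most rho / 2^k carry at least the fraction
    2^(- k (1 - alpha)) >= 1 - k (1 - alpha) of the energy, the others carry at
    most the fraction k (1 - alpha). *)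
Lemma close_energy_gap rho k : (alpha < 1)%R -> (0 < k)%N ->
  (forall y z, E y -> F z -> E (midpoint y z) \/ F (midpoint y z)) ->
  \int[mu \x mu]_(p in close_pairs E F rho `\` close_pairs E F (rho / 2 ^+ k))
    frac_kernel alpha p
  <= (k%:R * (1 - alpha))%:E * close_energy alpha E F rho.
Proof.
move=> alpha1 k0 midEF.
set S := close_pairs E F rho; set S' := close_pairs E F (rho / 2 ^+ k).
have mS : measurable S by exact: measurable_close_pairs.
have mS' : measurable S' by exact: measurable_close_pairs.
have [rho0|rho0] := ltP rho 0%R.
  rewrite (_ : S `\` S' = set0).
    rewrite integral_set0 mule_ge0 ?close_energy_ge0//.
    by rewrite lee_fin mulr_ge0// subr_ge0 ltW.
  apply/seteqP; split => // p [[_ _ prho] _]; exfalso.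
  by have := eucl_norm_ge0 (p.1 - p.2); rewrite leNgt (le_lt_trans prho).
have S'S : S' `<=` S.
  move=> p [Ep Fp prho]; split => //; apply: (le_trans prho).
  by rewrite ler_pdivrMr ?exprn_gt0// ler_peMr// exprn_ege1// ler1n.
have split_energy : close_energy alpha E F rho =
    \int[mu \x mu]_(p in S `\` S') frac_kernel alpha p +
    close_energy alpha E F (rho / 2 ^+ k).
  rewrite /close_energy -/S -/S' -{1}(setDUK S'S) setUC.
  apply: (ge0_integral_setU (mu \x mu) (measurableD mS mS') mS') => //.
    by move=> p _; exact: frac_kernel_ge0.
  by rewrite disj_set2E setIC setDIK eqxx.
have := close_energy_iter_half alpha mE mF midEF rho k.
have : 0 <= \int[mu \x mu]_(p in S `\` S') frac_kernel alpha p.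
  by apply: integral_ge0 => p _; exact: frac_kernel_ge0.
have : 0 <= close_energy alpha E F (rho / 2 ^+ k) by exact: close_energy_ge0.
move: split_energy.
set G := \int[mu \x mu]_(p in S `\` S') _.
set J := close_energy alpha E F rho.
set J' := close_energy alpha E F (rho / 2 ^+ k).
clearbody G J J' => JE J'0 G0.
have t0 : (0 < k%:R * (1 - alpha))%R by rewrite mulr_gt0 ?ltr0n// subr_gt0.
have := sub1_le_powR2N (ltW t0).
move: (k%:R * (1 - alpha))%R (2 `^ _)%R t0 => t q t0 tq qJ.
(* An infinite energy cannot be subtracted, but then the bound is trivial. *)
have [Joo|Joo] := eqVneq J +oo.
  by rewrite Joo mulr_infty gtr0_sg// mul1e leey.
have Jfin : J \is a fin_num.
  by rewrite ge0_fin_numE ?ltey// JE adde_ge0.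
have : G \is a fin_num /\ J' \is a fin_num.
  by move: Jfin; rewrite JE fin_numD => /andP[].
case=> /fineK Gfin /fineK J'fin; move/fineK: Jfin JE J'0 G0 qJ => <-.
rewrite -Gfin -J'fin -EFinM -EFinD -EFinM !lee_fin => -[JE] J'0 G0 qJ.
move: (fine J) (fine J') (fine G) JE J'0 G0 qJ => j j' g JE j'0 g0 qj.
have j0 : (0 <= j)%R by rewrite JE addr_ge0.
nra.
Qed.

(** On pairs at distance at most rho the kernel is at least rho^(- alpha - n); it
    then remains to count the pairs, for y in E, by sections. *)
Lemma gap_energy_ge rho rho' (v : R) : (0 <= v)%R ->
  E `&` F = set0 ->
  (forall y z, E y -> F z -> (eucl_norm (y - z) <= rho)%R) ->
  (forall y, E y -> v%:E <= mu (F `\` [set z | (eucl_norm (y - z) <= rho')%R])) ->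
  (rho `^ (- (alpha + n%:R)))%:E * (v%:E * mu E) <=
  \int[mu \x mu]_(p in close_pairs E F rho `\` close_pairs E F rho')
    frac_kernel alpha p.
Proof.
move=> v0 EF0 EFrho vF.
set G := _ `\` _.
have mG : measurable G by apply: measurableD; exact: measurable_close_pairs.
have c0 : (0 <= rho `^ (- (alpha + n%:R)))%R by exact: powR_ge0.
apply: (@le_trans _ _ (\int[mu \x mu]_(p in G) (cst (rho `^ (- (alpha + n%:R)))%:E p))).
  rewrite (integral_cst (mu \x mu) mG).
  apply: lee_wpmul2l; first by rewrite lee_fin.
  rewrite -(integral_cst mu mE v%:E).
  have mX := measurable_fun_xsection mu mG.
  apply: (@le_trans _ _ (\int[mu]_(y in E) (mu \o xsection G) y)).
    apply: ge0_le_integral => //.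
    - exact: measurable_funTS mX.
    - move=> y Ey /=.
      rewrite (_ : xsection G y =
          F `\` [set z | (eucl_norm (y - z) <= rho')%R]).
        exact: vF.
      apply/seteqP; split => z; rewrite /xsection /= inE.
        by move=> [[_ /= Fz _] yz]; split => // zrho; apply: yz.
      move=> [Fz yz]; split; last by move=> [].
      by split => //=; exact: EFrho.
  apply: (ge0_subset_integral mu mE measurableT mX) => // y _; exact: measure_ge0.
apply: ge0_le_integral => //.
- move=> [y z] [[/= Ey Fz yz] _]; apply: frac_kernel_ge => // yz0.
  by have : (E `&` F) y by [split=> //; rewrite yz0]; rewrite EF0.
Qed.

(** The source of the factor 1 - alpha: a lower bound on the energy of far
    apart pairs is improved to one on the whole energy by [close_energy_gap]. *)
Lemma near_energy_ge rho k (v : R) : (alpha < 1)%R -> (0 < k)%N -> (0 <= v)%R ->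
  E `&` F = set0 ->
  (forall y z, E y -> F z -> E (midpoint y z) \/ F (midpoint y z)) ->
  (forall y z, E y -> F z -> (eucl_norm (y - z) <= rho)%R) ->
  (forall y, E y ->
    v%:E <= mu (F `\` [set z | (eucl_norm (y - z) <= rho / 2 ^+ k)%R])) ->
  (rho `^ (- (alpha + n%:R)))%:E * (v%:E * mu E) <=
  (k%:R * (1 - alpha))%:E *
    \int[mu]_(y in E) \int[mu]_(z in F) frac_kernel alpha (y, z).
Proof.
move=> alpha1 k0 v0 EF0 midEF EFrho vF.
apply: (le_trans (gap_energy_ge v0 EF0 EFrho vF)).
apply: (le_trans (close_energy_gap rho alpha1 k0 midEF)).
apply: lee_wpmul2l; first by rewrite lee_fin mulr_ge0// subr_ge0 ltW.
rewrite -(ge0_integral_setX mu mu mE mF (@measurable_frac_kernel R n alpha)); last first.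
  by move=> p; exact: frac_kernel_ge0.
apply: ge0_subset_integral => //.
- exact: measurable_close_pairs.
- exact: measurableX.
- by move=> p _; exact: frac_kernel_ge0.
- by move=> p [].
Qed.

End gap.

(** * Dyadic cubes *)

Section box.
Context {R : realType} {n : nat}.
Local Notation mu := (@lebesgue_measure_rV R n).

Lemma measurable_box (A : 'I_n -> set R) : (forall i, measurable (A i)) ->
  measurable [set v : 'rV[R]_n | forall i, A i (v 0 i)].
Proof.
move=> mA; rewrite (_ : mkset _ = \bigcap_(i in [set: 'I_n])
    ((fun v : 'rV[R]_n => v 0 i) @^-1` A i)).
  apply: fin_bigcap_measurable => // i _.
  by rewrite -[X in measurable X]setTI; exact: measurable_entry.
by apply/seteqP; split => v /= vA i; [move=> _; exact: vA|exact: vA].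
Qed.

Lemma lebesgue_measure_rV_cube (A : 'I_n -> set R) (l : R) :
  (forall i, measurable (A i)) -> (forall i, lebesgue_measure (A i) = l%:E) ->
  mu [set v | forall i, A i (v 0 i)] = (l ^+ n)%:E.
Proof.
move=> mA Al; rewrite lebesgue_measure_rV_box//.
under eq_bigr do rewrite Al.
by rewrite -(big_morph EFin EFinM erefl) prodr_const card_ord.
Qed.

Lemma lebesgue_measure_rV_le_cube (y : 'rV[R]_n) (A : set 'rV[R]_n) (r : R) :
  0 <= r -> measurable A -> (forall v, A v -> forall i, `|y 0 i - v 0 i| <= r) ->
  (mu A <= ((2 * r) ^+ n)%:E)%E.
Proof.
move=> r0 mA Ar.
have mI i : measurable (`[y 0 i - r, y 0 i + r]%classic : set R).
  exact: measurable_itv.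
rewrite -(@lebesgue_measure_rV_cube (fun i => `[y 0 i - r, y 0 i + r]%classic))//.
  apply: le_measure; rewrite ?inE//; first exact: (measurable_box mI).
  move=> v Av i /=; rewrite in_itv /=.
  by have := Ar v Av i; rewrite ler_distlC => /andP[h1 h2]; apply/andP; split; lra.
move=> i; rewrite lebesgue_measure_itv /= lte_fin.
case: ifPn => [_|]; first by rewrite -EFinD; congr EFin; ring.
rewrite -leNgt => h; congr EFin; lra.
Qed.

End box.

Section dyadic.
Context {R : realType} {n : nat}.
Local Notation mu := (@lebesgue_measure_rV R n).
Implicit Types (k j : int) (x y z v : 'rV[R]_n).

Definition side k : R := 2 ^ k.

Definition dyadic_index k x : 'rV[int]_n := \row_i Num.floor (x 0 i / side k).

(** A cube is represented by any of its points; distinct cubes of the same level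
    are then the classes of an equivalence relation. *)
Definition dyadic_cube k x : set 'rV[R]_n :=
  [set v | dyadic_index k v = dyadic_index k x].

Lemma side_gt0 k : 0 < side k.
Proof. by rewrite exprz_gt0. Qed.

Lemma sideD k (m : nat) : side (k + m%:Z) = side k * 2 ^+ m.
Proof. by rewrite /side expfzDr. Qed.

Lemma dyadic_cubeP k x v : dyadic_cube k x v <-> forall i,
  ((dyadic_index k x 0 i)%:~R * side k <= v 0 i <
   ((dyadic_index k x 0 i)%:~R + 1) * side k).
Proof.
have s0 := side_gt0 k.
split => [xv i|H].
  have := floor_itv (v 0 i / side k).
  have -> : Num.floor (v 0 i / side k) = dyadic_index k x 0 i by rewrite -xv mxE.
  by rewrite intrD ler_pdivlMr// ltr_pdivrMr.
apply/rowP => i; rewrite mxE; apply: floor_def.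
by rewrite intrD ler_pdivlMr// ltr_pdivrMr.
Qed.

Lemma dyadic_cube_refl k x : dyadic_cube k x x.
Proof. by []. Qed.

Lemma dyadic_cubeE k x : dyadic_cube k x = [set v | forall i,
  `[(dyadic_index k x 0 i)%:~R * side k,
    ((dyadic_index k x 0 i)%:~R + 1) * side k[%classic (v 0 i)].
Proof.
apply/seteqP; split => v.
  by move/dyadic_cubeP => H i; have := H i; rewrite /= in_itv.
by move=> H; apply/dyadic_cubeP => i; have := H i; rewrite /= in_itv.
Qed.

Lemma measurable_dyadic_cube k x : measurable (dyadic_cube k x).
Proof.
have mI (a b : R) : measurable (`[a, b[%classic : set R) by exact: measurable_itv.
by rewrite dyadic_cubeE; apply: (measurable_box (fun i => mI _ _)).
Qed.

Lemma lebesgue_measure_dyadic_cube k x : mu (dyadic_cube k x) = (side k ^+ n)%:E.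
Proof.
have mI (a b : R) : measurable (`[a, b[%classic : set R) by exact: measurable_itv.
rewrite dyadic_cubeE; apply: (lebesgue_measure_rV_cube (fun i => mI _ _)) => i.
rewrite lebesgue_measure_itv /= lte_fin ltr_pM2r ?side_gt0// ltrDl ltr01.
by rewrite -EFinD; congr EFin; ring.
Qed.

Lemma dyadic_cube_dist_entry k x y z i : dyadic_cube k x y -> dyadic_cube k x z ->
  `|(y - z) 0 i| <= side k.
Proof.
move=> /dyadic_cubeP/(_ i)/andP[y1 y2] /dyadic_cubeP/(_ i)/andP[z1 z2].
rewrite !mxE ler_norml; apply/andP; split; lra.
Qed.

Lemma dyadic_cube_dist k x y z : dyadic_cube k x y -> dyadic_cube k x z ->
  eucl_norm (y - z) <= n%:R * side k.
Proof.
move=> xy xz; apply: eucl_norm_le; first exact/ltW/side_gt0.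
by move=> i; exact: dyadic_cube_dist_entry xy xz.
Qed.

Lemma dyadic_cube_midpoint k x y z : dyadic_cube k x y -> dyadic_cube k x z ->
  dyadic_cube k x (midpoint y z).
Proof.
move=> /dyadic_cubeP xy /dyadic_cubeP xz; apply/dyadic_cubeP => i.
have /andP[y1 y2] := xy i; have /andP[z1 z2] := xz i.
have -> : midpoint y z 0 i = (y 0 i + z 0 i) / 2 by rewrite !mxE mulrC.
by apply/andP; split; lra.
Qed.

(** With b the index of the parent, the index a of the child satisfies
    2 b <= a < 2 b + 2, both sides being integers, so the child lies inside the
    parent. *)
Lemma dyadic_index_parent k x y : dyadic_index k x = dyadic_index k y ->
  dyadic_index (k + 1) x = dyadic_index (k + 1) y.
Proof.
move=> kxy; apply/esym/(_ : dyadic_cube _ _ _)/dyadic_cubeP => i.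
have s0 := side_gt0 k.
rewrite (_ : side (k + 1) = 2 * side k); last by rewrite (sideD k 1) mulrC.
have /dyadic_cubeP/(_ i) := dyadic_cube_refl (k + 1) x.
have /dyadic_cubeP/(_ i) := dyadic_cube_refl k x.
have /dyadic_cubeP/(_ i) := (esym kxy : dyadic_cube k x y).
rewrite (_ : side (k + 1) = 2 * side k); last by rewrite (sideD k 1) mulrC.
move: (dyadic_index k x 0 i) (dyadic_index (k + 1) x 0 i) => a b.
move=> /andP[y1 y2] /andP[x1 x2] /andP[b1 b2].
have ba : (b * 2 < a + 1)%R.
  rewrite -(@ltr_int R) intrD intrM -(ltr_pM2r s0); lra.
have ab : (a < (b + 1) * 2)%R.
  rewrite -(@ltr_int R) !(intrD, intrM) -(ltr_pM2r s0); lra.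
have {}ba : (b * 2 <= a)%R by rewrite -ltzD1.
have {}ab : (a + 1 <= (b + 1) * 2)%R by rewrite lezD1.
move: ba ab; rewrite -!(@ler_int R) !(intrD, intrM) => ba ab.
have := ler_wpM2r (ltW s0) ba; have := ler_wpM2r (ltW s0) ab.
by move=> h1 h2; apply/andP; split; lra.
Qed.

Lemma dyadic_index_ancestor k (m : nat) x y : dyadic_index k x = dyadic_index k y ->
  dyadic_index (k + m%:Z) x = dyadic_index (k + m%:Z) y.
Proof.
move=> kxy; elim: m => [|m ih]; first by rewrite addr0.
have -> : k + m.+1%:Z = k + m%:Z + 1 by rewrite -addrA -PoszD addn1.
exact: dyadic_index_parent.
Qed.

Lemma dyadic_cube_ancestor k (m : nat) x :
  dyadic_cube k x `<=` dyadic_cube (k + m%:Z) x.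
Proof. by move=> v xv; exact: dyadic_index_ancestor. Qed.

End dyadic.

(** * Maximal dense cubes *)

Section stopping.
Context {R : realType} {n : nat}.
Local Notation mu := (@lebesgue_measure_rV R n).
Implicit Types (k j : int) (x y z v : 'rV[R]_n).
Variable U : set 'rV[R]_n.

(** The threshold 2^-(n+1) is such that a cube whose parent is not dense is at
    most half filled by [U]. *)
Definition dense_cube k x : Prop :=
  (((2 ^+ n.+1)^-1 * side k ^+ n)%:E <= mu (U `&` dyadic_cube k x))%E.

Definition stopping_level k x : Prop :=
  dense_cube k x /\ forall j, k < j -> ~ dense_cube j x.

Lemma dyadic_cube_eq k x y : dyadic_cube k x y -> dyadic_cube k x = dyadic_cube k y.
Proof. by move=> xy; rewrite /dyadic_cube xy. Qed.

(** Two maximal dense cubes sharing a point v are nested, so the larger one is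
    an ancestor of the smaller one and contradicts its maximality. *)
Lemma stopping_level_le k j x y v :
  stopping_level k x -> dyadic_cube k x v ->
  stopping_level j y -> dyadic_cube j y v -> k <= j -> k = j.
Proof.
move=> [_ Hk] xv [Hj _] yv kj; apply/eqP; rewrite eq_le kj /= leNgt.
apply/negP => ltkj; apply: (Hk _ ltkj).
have [m jE] : exists m : nat, j = k + m%:Z.
  by exists `|j - k|%N; lia.
move: Hj; rewrite /dense_cube (dyadic_cube_eq yv).
suff -> : dyadic_cube j v = dyadic_cube j x by [].
by apply/esym/dyadic_cube_eq; rewrite jE; exact: dyadic_cube_ancestor.
Qed.

(** Levels of dense cubes around x are bounded above, since the volume of [U] is
    finite, and the cubes of very negative level lie inside the open set [U]. *)
Lemma stopping_level_exists x : (0 < n)%N -> open U -> bounded_set U -> U x ->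
  exists k, stopping_level k x.
Proof.
move=> n0 oU bU Ux; have mU := open_measurable_rV oU.
have [N UN] : exists N : nat, forall j, dense_cube j x -> j <= N%:Z.
  have [M [M0 UM]] : exists M : R, 0 <= M /\
      forall v, U v -> forall i, `|(0 : 'rV[R]_n) 0 i - v 0 i| <= M.
    have [M0 [_ UM0]] := bU; exists (`|M0| + 2); split; first by rewrite addr_ge0.
    move=> v Uv i.
    have vM : `|v| <= `|M0| + 1.
      by apply: UM0 => //; rewrite (le_lt_trans (ler_norm _))// ltrDl.
    have : ball (0 : 'rV[R]_n) (`|M0| + 2) v.
      by rewrite -ball_normE /= sub0r normrN (le_lt_trans vM)// ltrD2l ltr1n.
    by case=> _ /(_ 0 i)/ltW.
  have muU := lebesgue_measure_rV_le_cube M0 mU UM.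
  pose a : R := 2 ^+ n.+1 * (2 * M) ^+ n.
  have a0 : 0 <= a by rewrite mulr_ge0 ?exprn_ge0// mulr_ge0.
  pose N := Num.Def.archi_bound a.
  exists N => j xj; rewrite leNgt; apply/negP => Nj.
  have [p jE] : exists p : nat, j = 0 + (N + p)%N%:Z by exists `|j - N%:Z|%N; lia.
  have aj : a < side j ^+ n.
    apply: (lt_le_trans (archi_boundP a0)).
    rewrite jE sideD /side expr0z mul1r -exprM -natrX ler_nat.
    apply: (leq_trans (ltnW (ltn_expl N (ltnSn 1)))).
    by rewrite leq_exp2l// (leq_trans (leq_addr p N))// leq_pmulr.
  have UQ : (mu (U `&` dyadic_cube j x) <= mu U)%E.
    apply: le_measure; rewrite ?inE//.
    by apply: measurableI => //; exact: measurable_dyadic_cube.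
  have := le_trans xj (le_trans UQ muU); rewrite lee_fin leNgt => /negP; apply.
  by rewrite ltr_pdivlMl ?exprn_gt0.
have [m xm] : exists m : nat, dense_cube (- m%:Z) x.
  have /nbhs_ballP[e /= e0 xeU] : nbhs x U by exact: open_nbhs_nbhs.
  have ei0 : 0 <= e^-1 by rewrite invr_ge0 ltW.
  pose m := Num.Def.archi_bound e^-1; exists m.
  have me : side (- m%:Z) < e.
    rewrite -[ltRHS]invrK /side -invr_expz ltf_pV2 ?posrE ?invr_gt0 ?exprn_gt0//.
    apply: (lt_le_trans (archi_boundP ei0)).
    by rewrite -exprnP -natrX ler_nat ltnW// ltn_expl.
  rewrite /dense_cube (setIidr _) ?lebesgue_measure_dyadic_cube ?lee_fin.
    rewrite ler_piMl ?exprn_ge0 ?(ltW (side_gt0 _))//.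
    by rewrite invf_le1 ?exprn_gt0// exprn_ege1// ler1n.
  move=> v xv; apply: xeU; split => // i j; rewrite ord1.
  have := dyadic_cube_dist_entry j (dyadic_cube_refl (- m%:Z) x) xv.
  by rewrite !mxE => xv'; exact: le_lt_trans me.
have exP : exists p : nat, `[< dense_cube (- m%:Z + p%:Z) x >].
  by exists 0%N; rewrite addr0; exact/asboolP.
have ubP p : `[< dense_cube (- m%:Z + p%:Z) x >] -> (p <= N + m)%N.
  by move=> /asboolP/UN; lia.
have [p /asboolP xp pmax] := ex_maxnP exP ubP.
exists (- m%:Z + p%:Z); split => // j pj xj.
have jE : j = - m%:Z + (absz (j + m%:Z))%:Z by lia.
have := pmax (absz (j + m%:Z)); rewrite -jE asboolT// => /(_ isT); lia.
Qed.

End stopping.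

(** * Energy of a maximal dense cube *)

(** Homogeneity of the kernel: this is where the constants cease to depend on
    alpha, by bounding n^(alpha + n) by n^(n + 1). *)
Lemma kernel_scale_ge (R : realType) (n : nat) (alpha s : R) :
  (0 < n)%N -> alpha < 1 -> 0 < s ->
  (n%:R ^+ n.+1)^-1 * s `^ (- alpha) <= (n%:R * s) `^ (- (alpha + n%:R)) * s ^+ n.
Proof.
move=> n0 alpha1 s0.
have s1 : s != 0 by rewrite gt_eqF.
rewrite powRM ?ler0n ?(ltW s0)// -mulrA.
have -> : s `^ (- (alpha + n%:R)) * s ^+ n = s `^ (- alpha).
  rewrite -powR_mulrn ?(ltW s0)// -powRD ?s1 ?implybT//.
  by congr (_ `^ _); ring.
rewrite ler_wpM2r ?powR_ge0//.
rewrite -powR_mulrn ?ler0n// -powRN ler_powR ?ler1n// lerN2 -natr1; lra.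
Qed.

Section kernel_integral.
Context {R : realType} {n : nat}.
Local Open Scope ereal_scope.
Local Notation mu := (@lebesgue_measure_rV R n).

Lemma measurable_kernel_integral (alpha : R) (F : set 'rV[R]_n) : measurable F ->
  measurable_fun setT (fun y => \int[mu]_(z in F) frac_kernel alpha (y, z)).
Proof.
move=> mF; have mTF : measurable ([set: 'rV[R]_n] `*` F) by exact: measurableX.
pose f := frac_kernel alpha \_ ([set: 'rV[R]_n] `*` F).
have mf : measurable_fun setT f.
  apply: (iffLR (measurable_restrictT _ mTF)).
  apply: measurable_funTS; exact: measurable_frac_kernel.
have f0 p : 0 <= f p by rewrite /f patchE; case: ifP => // _; exact: frac_kernel_ge0.
rewrite (_ : (fun _ => _) = fun y => \int[mu]_z f (y, z)).
  exact: (measurable_fun_fubini_tonelli_F (m2 := mu) f mf f0).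
apply/funext => y; rewrite integral_mkcond; apply: eq_integral => z _.
by rewrite /f !patchE in_setX in_setT.
Qed.

Lemma measurable_frac_kernel1 (alpha : R) (D : set 'rV[R]_n) y :
  measurable_fun D (fun z => frac_kernel alpha (y, z)).
Proof.
apply: measurable_funTS; apply: (measurableT_comp (measurable_frac_kernel alpha)).
exact: measurable_pair1.
Qed.

Lemma kernel_integral_ge0 (alpha : R) (D : set 'rV[R]_n) y :
  0 <= \int[mu]_(z in D) frac_kernel alpha (y, z).
Proof. by apply: integral_ge0 => z _; exact: frac_kernel_ge0. Qed.

Lemma kernel_integral_le (alpha : R) (D D' : set 'rV[R]_n) y :
  measurable D -> measurable D' -> D `<=` D' ->
  \int[mu]_(z in D) frac_kernel alpha (y, z) <=
  \int[mu]_(z in D') frac_kernel alpha (y, z).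
Proof.
move=> mD mD' DD'; apply: ge0_subset_integral => //.
  exact: measurable_frac_kernel1.
by move=> z _; exact: frac_kernel_ge0.
Qed.

Lemma measure_ge_of_cover (A B D : set 'rV[R]_n) (a b : R) :
  measurable A -> measurable B -> measurable D -> D `<=` A `|` B ->
  a%:E <= mu D -> mu B <= b%:E -> (a - b)%:E <= mu A.
Proof.
move=> mA mB mD DAB aD Bb; rewrite EFinB leeBlDr//.
apply: (le_trans aD); apply: (@le_trans _ _ (mu (A `|` B))).
  by apply: le_measure; rewrite ?inE//; exact: measurableU.
by apply: (le_trans (measureU2 _ _ _)) => //; exact: leeD2l.
Qed.

End kernel_integral.

Section stopping_bounds.
Context {R : realType} {n : nat}.
Local Open Scope ereal_scope.
Local Notation mu := (@lebesgue_measure_rV R n).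
Variables (U : set 'rV[R]_n) (alpha : R) (k : int) (x : 'rV[R]_n).
Hypotheses (n_gt0 : (0 < n)%N) (mU : measurable U).
Hypotheses (alpha_gt0 : (0 < alpha)%R) (alpha_lt1 : (alpha < 1)%R).
Hypothesis kx : stopping_level U k x.

Let Q := dyadic_cube k x.
Let s : R := side k.
Let delta : R := (2 ^+ n.+1)^-1%R.

Let s_gt0 : (0 < s)%R. Proof. exact: side_gt0. Qed.
Let delta_gt0 : (0 < delta)%R. Proof. by rewrite invr_gt0 exprn_gt0. Qed.
Let mQ j (y : 'rV[R]_n) : measurable (dyadic_cube j y).
Proof. exact: measurable_dyadic_cube. Qed.

Let mUQ j (y : 'rV[R]_n) : measurable (U `&` dyadic_cube j y).
Proof. by apply: measurableI. Qed.

Lemma ancestor_sparse (m : nat) :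
  mu (U `&` dyadic_cube (k + m.+1%:Z) x) <= (delta * (s * 2 ^+ m.+1) ^+ n)%:E.
Proof.
have [_ /(_ (k + m.+1%:Z)%R)] := kx.
rewrite ltrDl ltz_nat /dense_cube => /(_ isT)/negP; rewrite -ltNge => /ltW.
by rewrite sideD.
Qed.

Lemma stopping_cube_half : mu (U `&` Q) <= (s ^+ n / 2)%:E.
Proof.
apply: (@le_trans _ _ (mu (U `&` dyadic_cube (k + 1%:Z) x))).
  apply: le_measure; [by apply: mem_set; exact: mUQ|by apply: mem_set; exact: mUQ|].
  by apply: setIS; exact: dyadic_cube_ancestor.
apply: (le_trans (ancestor_sparse 0)); rewrite lee_fin expr1 /delta exprMn exprSr.
have n2 : (2 ^+ n != 0 :> R)%R by rewrite expf_neq0.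
by rewrite le_eqVlt; apply/orP; left; apply/eqP; field.
Qed.

(** The exponent 8 n is chosen so that 2^(8 n) >= 8 n: the removed ball then has
    radius at most s / 8 and volume at most s^n / 4, while [U] takes at most
    s^n / 2 of the cube. *)
Lemma stopping_cube_rest_ge (y : 'rV[R]_n) :
  (s ^+ n / 4)%:E <=
  mu ((Q `\` U) `\` [set z | eucl_norm (y - z) <= n%:R * s / 2 ^+ (8 * n)]%R).
Proof.
set r : R := (n%:R * s / 2 ^+ (8 * n))%R.
set B := [set z | _].
have mB : measurable B.
  have md : measurable_fun setT (fun z : 'rV[R]_n => eucl_norm (y - z)).
    exact: (measurableT_comp (@measurable_eucl_dist R n) (measurable_pair1 y)).
  rewrite -[B]setTI; exact: measurable_fun_le.
have r0 : (0 <= r)%R by rewrite divr_ge0 ?exprn_ge0// mulr_ge0// ltW.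
have rs : (2 * r <= s / 4)%R.
  rewrite /r mulrA ler_pdivrMr ?exprn_gt0//.
  have : (8%:R * n%:R <= 2 ^+ (8 * n) :> R)%R.
    by rewrite -natrM -natrX ler_nat ltnW// ltn_expl.
  move: (2 ^+ (8 * n))%R => t nt.
  have := ler_wpM2r (ltW s_gt0) nt; lra.
have mQB : measurable (Q `&` B) by exact: (measurableI _ _ (mQ k x) mB).
have mQUB : measurable ((Q `\` U) `\` B).
  exact: (measurableD (measurableD (mQ k x) mU) mB).
have mUQB := measurableU _ _ (mUQ k x) mQB.
have muB : mu (Q `&` B) <= (s ^+ n / 4)%:E.
  apply: (@le_trans _ _ ((2 * r) ^+ n)%:E).
    apply: (lebesgue_measure_rV_le_cube (y := y)) => //.
    move=> v [_ yv] i; apply: le_trans yv.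
    by have := normr_le_eucl_norm (y - v) i; rewrite !mxE.
  rewrite lee_fin; apply: (@le_trans _ _ ((s / 4) ^+ n)%R).
    by apply: lerXn2r => //; rewrite nnegrE; [lra|have := s_gt0; lra].
  rewrite exprMn ler_wpM2l ?exprn_ge0 ?(ltW s_gt0)//.
  by rewrite -[leRHS]expr1 ler_wiXn2l// invf_le1// ler1n.
have -> : (s ^+ n / 4 = s ^+ n - (s ^+ n / 2 + s ^+ n / 4))%R by field.
apply: (measure_ge_of_cover mQUB mUQB (mQ k x)).
- move=> v Qv; have [Uv|nUv] := pselect (U v); first by right; left.
  by have [Bv|nBv] := pselect (B v); [right; right|left].
- by rewrite lebesgue_measure_dyadic_cube.
- rewrite EFinD; apply: (le_trans (measureU2 _ (mUQ k x) mQB)).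
  by apply: leeD => //; exact: stopping_cube_half.
Qed.

Lemma stopping_cube_near_energy :
  (delta / 4 * ((n%:R ^+ n.+1)^-1 * s `^ (- alpha)) * s ^+ n)%:E <=
  ((8 * n)%:R * (1 - alpha))%:E *
    \int[mu]_(y in U `&` Q) \int[mu]_(z in ~` U) frac_kernel alpha (y, z).
Proof.
have mE : measurable (U `&` Q) := mUQ k x.
have mF : measurable (Q `\` U) := measurableD (mQ k x) mU.
have s40 : (0 <= s ^+ n / 4)%R by rewrite divr_ge0 ?exprn_ge0// ltW.
have near : ((n%:R * s) `^ (- (alpha + n%:R)))%:E * ((s ^+ n / 4)%:E * mu (U `&` Q)) <=
    ((8 * n)%:R * (1 - alpha))%:E *
    \int[mu]_(y in U `&` Q) \int[mu]_(z in Q `\` U) frac_kernel alpha (y, z).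
  apply: (near_energy_ge alpha_gt0 mE mF alpha_lt1 _ s40).
  - by rewrite muln_gt0.
  - by apply/seteqP; split => // v [[Uv _] [_ /(_ Uv)]].
  - move=> y z [_ Qy] [Qz _].
    have [Um|nUm] := pselect (U (midpoint y z)).
      by left; split => //; exact: dyadic_cube_midpoint.
    by right; split => //; exact: dyadic_cube_midpoint.
  - by move=> y z [_ Qy] [Qz _]; exact: dyadic_cube_dist Qy Qz.
  - by move=> y _; exact: stopping_cube_rest_ge.
apply: (@le_trans _ _ (((n%:R * s) `^ (- (alpha + n%:R)))%:E *
    ((s ^+ n / 4)%:E * (delta * s ^+ n)%:E))).
  rewrite -!EFinM lee_fin.
  have := kernel_scale_ge n_gt0 alpha_lt1 s_gt0.
  have d40 : (0 <= delta / 4)%R by rewrite divr_ge0// ltW.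
  have sn0 : (0 <= s ^+ n)%R by rewrite exprn_ge0// ltW.
  move=> /(ler_wpM2l d40)/(ler_wpM2r sn0)/le_trans; apply.
  by rewrite le_eqVlt; apply/orP; left; apply/eqP; ring.
apply: (le_trans _ (le_trans near _)).
  apply: lee_wpmul2l; first by rewrite lee_fin powR_ge0.
  by apply: lee_wpmul2l; [rewrite lee_fin|have [] := kx].
apply: lee_wpmul2l; first by rewrite lee_fin mulr_ge0// subr_ge0 ltW.
apply: ge0_le_integral => //.
- by move=> y _; exact: kernel_integral_ge0.
- by apply: measurable_funTS; exact: measurable_kernel_integral.
- by apply: measurable_funTS; apply: measurable_kernel_integral; exact: measurableC.
- move=> y _; apply: kernel_integral_le => //; exact: measurableC.
Qed.

(** Of the outer cube of side L, the inner cube takes at most half and [U] at most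
    a quarter, as 2^-(n+1) <= 1/4; both use n > 0. *)
Lemma annulus_ge (m : nat) :
  ((s * 2 ^+ m.+1) ^+ n / 4)%:E <=
  mu ((dyadic_cube (k + m.+1%:Z) x `\` dyadic_cube (k + m%:Z) x) `\` U).
Proof.
have mD := measurableD (measurableD (mQ (k + m.+1%:Z) x) (mQ (k + m%:Z) x)) mU.
have mB := measurableU _ _ (mQ (k + m%:Z) x) (mUQ (k + m.+1%:Z) x).
set L := (s * 2 ^+ m.+1)%R.
have L0 : (0 <= L ^+ n)%R by rewrite exprn_ge0// mulr_ge0 ?exprn_ge0// ltW.
have inner_half : mu (dyadic_cube (k + m%:Z) x) <= (L ^+ n / 2)%:E.
  rewrite lebesgue_measure_dyadic_cube sideD lee_fin ler_pdivlMr// /L [in leRHS]exprS.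
  rewrite mulrCA [leRHS]exprMn mulrC.
  rewrite ler_wpM2r ?exprn_ge0 ?mulr_ge0 ?exprn_ge0 ?(ltW s_gt0)//.
  by rewrite -[leLHS]expr1 ler_weXn2l// ler1n.
have outer_quarter : mu (U `&` dyadic_cube (k + m.+1%:Z) x) <= (L ^+ n / 4)%:E.
  apply: (le_trans (ancestor_sparse m)); rewrite lee_fin mulrC ler_wpM2l//.
  rewrite /delta lef_pV2 ?posrE ?exprn_gt0//.
  rewrite (_ : 4 = 2 ^+ 2)%R; last by ring.
  by rewrite ler_weXn2l// ler1n.
have -> : (L ^+ n / 4 = L ^+ n - (L ^+ n / 2 + L ^+ n / 4))%R by field.
apply: (measure_ge_of_cover mD mB (mQ (k + m.+1%:Z) x)).
- move=> v Qv; have [Uv|nUv] := pselect (U v); first by right; right.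
  by have [Bv|nBv] := pselect (dyadic_cube (k + m%:Z) x v); [right; left|left].
- by rewrite lebesgue_measure_dyadic_cube sideD.
- rewrite EFinD.
  apply: (le_trans (measureU2 _ (mQ (k + m%:Z) x) (mUQ (k + m.+1%:Z) x))).
  exact: leeD inner_half outer_quarter.
Qed.

Lemma annulus_integral_ge (m : nat) y : Q y ->
  (((n%:R ^+ n.+1)^-1 / 4) * (s * 2 ^+ m.+1) `^ (- alpha))%:E <=
  \int[mu]_(z in (dyadic_cube (k + m.+1%:Z) x `\` dyadic_cube (k + m%:Z) x) `\` U)
    frac_kernel alpha (y, z).
Proof.
move=> Qy.
set D := _ `\` U.
have mD : measurable D.
  exact: (measurableD (measurableD (mQ (k + m.+1%:Z) x) (mQ (k + m%:Z) x)) mU).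
set L := (s * 2 ^+ m.+1)%R.
have L0 : (0 < L)%R by rewrite mulr_gt0 ?exprn_gt0.
pose c := ((n%:R * L) `^ (- (alpha + n%:R)))%R.
apply: (@le_trans _ _ (\int[mu]_(z in D) cst c%:E z)).
  rewrite integral_cst//.
  apply: (@le_trans _ _ (c%:E * (L ^+ n / 4)%:E)).
    have h := kernel_scale_ge n_gt0 alpha_lt1 L0.
    by rewrite -EFinM lee_fin [leLHS]mulrAC [leRHS]mulrA ler_pM2r// invr_gt0.
  apply: lee_wpmul2l; first by rewrite lee_fin powR_ge0.
  exact: annulus_ge.
apply: ge0_le_integral => //.
- by move=> z _; rewrite /= lee_fin powR_ge0.
- exact: measurable_frac_kernel1.
- move=> z [[Qz nQz] _]; apply: frac_kernel_ge => //.
    by move=> yz; apply: nQz; rewrite -yz; exact: dyadic_cube_ancestor.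
  rewrite /L -sideD; apply: (dyadic_cube_dist _ Qz).
  exact: dyadic_cube_ancestor.
Qed.

(** Every annulus is bounded below by the value for the outermost one, so that
    the sum over the annuli is just a multiplication. *)
Lemma annuli_integral_ge (N m : nat) y : (m <= N)%N -> Q y ->
  (m%:R * ((n%:R ^+ n.+1)^-1 / 4 * (s * 2 ^+ N) `^ (- alpha)))%:E <=
  \int[mu]_(z in (dyadic_cube (k + m%:Z) x `\` Q) `\` U) frac_kernel alpha (y, z).
Proof.
move=> + Qy; elim: m => [|m ih] mN; first by rewrite mul0r kernel_integral_ge0.
set A := _ `\` Q `\` U.
set B := (dyadic_cube (k + m%:Z) x `\` Q) `\` U.
set D := (dyadic_cube (k + m.+1%:Z) x `\` dyadic_cube (k + m%:Z) x) `\` U.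
have mB : measurable B by exact: (measurableD (measurableD (mQ _ _) (mQ _ _)) mU).
have mD : measurable D by exact: (measurableD (measurableD (mQ _ _) (mQ _ _)) mU).
have -> : A = B `|` D.
  have kk : dyadic_cube (k + m%:Z) x `<=` dyadic_cube (k + m.+1%:Z) x.
    have -> : (k + m.+1%:Z = k + m%:Z + 1%N%:Z)%R by rewrite -addrA -PoszD addn1.
    exact: dyadic_cube_ancestor.
  have Qk := @dyadic_cube_ancestor R n k m x.
  apply/seteqP; split=> [v [[Qv nQv] nUv]|v [[[Qv nQv] nUv]|[[Qv nQv] nUv]]].
  - by have [?|?] := pselect (dyadic_cube (k + m%:Z) x v); [left|right].
  - by split => //; split => //; exact: kk.
  - by split => //; split => // Qv'; apply: nQv; exact: Qk.
rewrite (ge0_integral_setU mu mB mD) //; last first.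
  rewrite disj_set2E; apply/eqP/seteqP; split => // v [[[Qv _] _] [[_ nQv] _]].
  exact: nQv.
  by move=> v _; exact: frac_kernel_ge0.
  exact: measurable_frac_kernel1.
rewrite -natr1 mulrDl mul1r EFinD; apply: leeD; first exact/ih/ltnW.
apply: (le_trans _ (annulus_integral_ge m Qy)).
rewrite lee_fin ler_wpM2l ?divr_ge0 ?invr_ge0 ?exprn_ge0//.
rewrite !powRN lef_pV2 ?posrE ?powR_gt0 ?mulr_gt0 ?exprn_gt0//.
apply: ge0_ler_powR; rewrite ?nnegrE ?(ltW alpha_gt0) ?mulr_ge0 ?exprn_ge0 ?(ltW s_gt0)//.
by rewrite ler_wpM2l ?(ltW s_gt0)// ler_weXn2l// ler1n.
Qed.

(** With N the least integer above 1/alpha, N annuli each contribute a constant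
    times (2^N s)^(- alpha), and 2^(- alpha N) >= 1/4 as alpha N <= 2. Summing
    them produces the factor 1/alpha. *)
Lemma far_integral_ge y : Q y ->
  ((n%:R ^+ n.+1)^-1 * s `^ (- alpha) / (16 * alpha))%:E <=
  \int[mu]_(z in ~` U) frac_kernel alpha (y, z).
Proof.
move=> Qy.
pose N := (Num.trunc alpha^-1).+1.
have a0 : (0 <= alpha^-1)%R by rewrite invr_ge0 ltW.
have /andP[N1 N2] := truncn_itv a0.
have N0 : (alpha^-1 <= N%:R)%R by exact: ltW.
have N3 : (N%:R <= alpha^-1 + 1)%R by rewrite /N -natr1 lerD2r.
have mC : measurable (~` U) by exact: measurableC.
have mD := measurableD (measurableD (mQ (k + N%:Z) x) (mQ k x)) mU.
apply: (@le_trans _ _ (\int[mu]_(z in (dyadic_cube (k + N%:Z) x `\` Q) `\` U)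
    frac_kernel alpha (y, z))); last first.
  by apply: kernel_integral_le => // z [].
apply: (le_trans _ (annuli_integral_ge (leqnn N) Qy)).
rewrite lee_fin powRM ?(ltW s_gt0) ?exprn_ge0//.
have q4 : (4^-1 <= (2 ^+ N) `^ (- alpha) :> R)%R.
  rewrite powRN lef_pV2 ?posrE ?powR_gt0 ?exprn_gt0//.
  rewrite -powR_mulrn// -powRrM.
  rewrite (_ : 4 = 2 `^ 2)%R; last by rewrite powR_mulrn//; ring.
  rewrite ler_powR ?ler1n//.
  have := ler_wpM2r (ltW alpha_gt0) N3.
  rewrite mulrDl mulVf ?gt_eqF// => h; apply: (le_trans h).
  by rewrite mul1r -[2%R]/(1 + 1)%R lerD2l ltW.
set p := (_ ^- n.+1)%R; set q := (s `^ _)%R; set w := (_ `^ _)%R.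
have p0 : (0 <= p)%R by rewrite invr_ge0 exprn_ge0.
have q0 : (0 <= q)%R by exact: powR_ge0.
have pq0 : (0 <= p * q)%R by exact: mulr_ge0.
have -> : (p * q / (16 * alpha) = alpha^-1 * (p / 4 * (q * 4^-1)))%R.
  by field; rewrite gt_eqF.
apply: ler_pM => //; first by rewrite !mulr_ge0// ?divr_ge0.
by rewrite ler_wpM2l ?divr_ge0// ler_wpM2l.
Qed.

Lemma stopping_cube_far_energy :
  ((n%:R ^+ n.+1)^-1 * s `^ (- alpha) / (16 * alpha) * (delta * s ^+ n))%:E <=
    \int[mu]_(y in U `&` Q) \int[mu]_(z in ~` U) frac_kernel alpha (y, z).
Proof.
set c := (_ / (16 * alpha))%R.
have c0 : (0 <= c)%R.
  by rewrite divr_ge0 ?mulr_ge0 ?powR_ge0 ?invr_ge0 ?exprn_ge0// ltW.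
apply: (@le_trans _ _ (\int[mu]_(y in U `&` Q) cst c%:E y)).
  rewrite (integral_cst mu (mUQ k x)) EFinM; apply: lee_wpmul2l; first by rewrite lee_fin.
  by have [] := kx.
apply: ge0_le_integral => //.
- exact: mUQ.
- by apply: measurable_funTS; apply: measurable_kernel_integral; exact: measurableC.
- by move=> y [_ Qy]; exact: far_integral_ge.
Qed.

(** [stopping_cube_far_energy] is used for alpha <= 1/2, where 1 - alpha >= 1/2,
    and [stopping_cube_near_energy] for alpha > 1/2. *)
Lemma stopping_cube_energy_ge :
  (delta * (n%:R ^+ n.+1)^-1 / (64 * n%:R) * s `^ (n%:R - alpha))%:E <=
  (alpha * (1 - alpha))%:E *
    \int[mu]_(y in U `&` Q) \int[mu]_(z in ~` U) frac_kernel alpha (y, z).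
Proof.
have far := stopping_cube_far_energy; have near := stopping_cube_near_energy.
set J := integral _ _ _ in near far *.
have -> : (s `^ (n%:R - alpha) = s `^ (- alpha) * s ^+ n)%R.
  rewrite -powR_mulrn ?(ltW s_gt0)// -powRD ?(gt_eqF s_gt0) ?implybT//.
  by rewrite addrC.
have n1 : (1 <= n%:R :> R)%R by rewrite ler1n.
have nn0 : (n%:R != 0 :> R)%R by rewrite pnatr_eq0 -lt0n.
pose A : R := (delta * (n%:R ^+ n.+1)^-1 * s `^ (- alpha) * s ^+ n)%R.
have A0 : (0 <= A)%R.
  by rewrite !mulr_ge0 ?powR_ge0 ?invr_ge0 ?exprn_ge0// ltW.
have a1 : (0 < 1 - alpha)%R by rewrite subr_gt0.
have -> : (delta * (n%:R ^+ n.+1)^-1 / (64 * n%:R) * (s `^ (- alpha) * s ^+ n) =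
   A / (64 * n%:R))%R by rewrite /A; ring.
have {}far : (A / (16 * alpha))%:E <= J.
  apply: le_trans far; rewrite lee_fin le_eqVlt; apply/orP; left; apply/eqP.
  by rewrite /A; ring.
have nA : (0 <= A / n%:R)%R by rewrite divr_ge0.
have {}near : (A / (32 * n%:R * (1 - alpha)))%:E <= J.
  have c0 : (0 < ((8 * n)%:R * (1 - alpha)) :> R)%R.
    by rewrite mulr_gt0// ltr0n muln_gt0.
  rewrite -(@lee_pmul2l _ ((8 * n)%:R * (1 - alpha))%:E) ?lte_fin//.
  apply: le_trans near; rewrite -EFinM lee_fin.
  have -> : ((8 * n)%:R * (1 - alpha) * (A / (32 * n%:R * (1 - alpha))) = A / 4)%R.
    by rewrite natrM; field; rewrite nn0 gt_eqF.
  by rewrite le_eqVlt; apply/orP; left; apply/eqP; rewrite /A; ring.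
have [ah|ah] := leP alpha (1 / 2)%R.
  apply: (@le_trans _ _ ((alpha * (1 - alpha))%:E * (A / (16 * alpha))%:E)).
    rewrite -EFinM lee_fin.
    have -> : (alpha * (1 - alpha) * (A / (16 * alpha)) = (1 - alpha) * (A / 16))%R.
      by field; rewrite gt_eqF.
    apply: (@le_trans _ _ (A / 64)%R).
      rewrite ler_wpM2l// lef_pV2 ?posrE ?mulr_gt0 ?ltr0n//.
      by rewrite ler_peMr.
    by nra.
  by apply: lee_wpmul2l => //; rewrite lee_fin mulr_ge0// ltW.
apply: (@le_trans _ _ ((alpha * (1 - alpha))%:E * (A / (32 * n%:R * (1 - alpha)))%:E)).
  rewrite -EFinM lee_fin.
  have -> : (alpha * (1 - alpha) * (A / (32 * n%:R * (1 - alpha))) =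
     alpha * (A / n%:R / 32))%R by field; rewrite nn0 gt_eqF.
  have -> : (A / (64 * n%:R) = A / n%:R / 64)%R by field.
  by nra.
by apply: lee_wpmul2l => //; rewrite lee_fin mulr_ge0// ltW.
Qed.

End stopping_bounds.

(** * The covering *)

Lemma esum_integral_le d (T : measurableType d) (R : realType)
    (mu : {measure set T -> \bar R}) (U : set T) (I : set nat)
    (F : nat -> set T) (g : T -> \bar R) :
  measurable U -> measurable_fun setT g -> (forall x, 0 <= g x)%E ->
  (forall i, I i -> measurable (F i)) -> (forall i, I i -> F i `<=` U) ->
  trivIset I F ->
  (\esum_(i in I) \int[mu]_(x in F i) g x <= \int[mu]_(x in U) g x)%E.
Proof.
move=> mU mg g0 mF FU tF.
pose F' i := if i \in I then F i else set0.
have mF' i : measurable (F' i).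
  by rewrite /F'; case: ifPn => // /set_mem; exact: mF.
have F'U : \bigcup_i F' i `<=` U.
  by move=> x [i _]; rewrite /F'; case: ifPn => // /set_mem /FU; exact.
have tF' : trivIset setT F'.
  move=> i j _ _ [x []]; rewrite /F'.
  case: ifPn => // /set_mem Ii Fi; case: ifPn => // /set_mem Ij Fj.
  by apply: tF => //; exists x.
have mgD (D : set T) : measurable_fun D g by exact: measurable_funTS.
have mF'U : measurable (\bigcup_i F' i) by exact: bigcup_measurable.
apply: (@le_trans _ _ (\int[mu]_(x in \bigcup_i F' i) g x)%E); last first.
  exact: ge0_subset_integral.
rewrite ge0_integral_bigcup// nneseries_esumT; last first.
  by move=> i; exact: integral_ge0.
rewrite esum_mkcond; apply: le_esum => i _; rewrite /F'.
by case: ifP => // _; rewrite integral_set0.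
Qed.

Theorem theorem1p2 (R : realType) (d : nat) (d_gt0 : (0 < d)%N) :
  exists C : R, 0 < C /\
    forall U : set 'rV[R]_d, open U -> bounded_set U ->
      exists (I : set nat) (x : nat -> 'rV[R]_d) (r : nat -> R),
        [/\ forall i, I i -> 0 < r i,
            U `<=` \bigcup_(i in I) eucl_ball (x i) (r i) &
            forall alpha : R, 0 < alpha -> alpha < 1 ->
              (\esum_(i in I) (r i `^ (d%:R - alpha))%:E <=
               (C * alpha * (1 - alpha))%:E * frac_perimeter alpha U)%E].
Proof.
pose kappa : R := (2 ^+ d.+1)^-1 * (d%:R ^+ d.+1)^-1 / (64 * d%:R).
have d0 : (0 < d%:R :> R) by rewrite ltr0n.
have kappa_gt0 : 0 < kappa.
  by rewrite !(mulr_gt0, divr_gt0) ?invr_gt0 ?exprn_gt0 ?mulr_gt0.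
pose C : R := d.+1%:R ^+ d / kappa.
have C_gt0 : 0 < C by rewrite divr_gt0 ?exprn_gt0 ?ltr0n.
exists C; split => // U oU bU.
have mU := open_measurable_rV oU.
have /choice[lev levP] : forall x, exists k, U x -> stopping_level U k x.
  move=> x; have [Ux|nUx] := pselect (U x); last by exists 0.
  by have [k kx] := stopping_level_exists d_gt0 oU bU Ux; exists k.
(* The cubes are enumerated by the codes of their level and index, and each is
   represented by a point [pt i] of U in it, which serves as center. *)
pose code (x : 'rV[R]_d) : nat := pickle (lev x, dyadic_index (lev x) x).
have codeP x y : code x = code y ->
    lev x = lev y /\ dyadic_index (lev x) x = dyadic_index (lev x) y.
  by move/(pcan_inj pickleK) => -[lxy ixy]; split => //; rewrite ixy lxy.
pose I : set nat := code @` U.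
have /choice[pt ptP] : forall i, exists x, I i -> U x /\ code x = i.
  move=> i; have [[x Ux xi]|nIi] := pselect (I i); first by exists x.
  by exists 0.
(* Points of a cube of side s are at distance at most d s, and balls are open. *)
pose r i : R := d.+1%:R * side (lev (pt i)).
exists I, pt, r; split.
- by move=> i _; rewrite mulr_gt0 ?ltr0n ?side_gt0.
- move=> x Ux; have Ix : I (code x) by exists x.
  have [_ /codeP[lx ix]] := ptP _ Ix; exists (code x) => //.
  have Qx : dyadic_cube (lev (pt (code x))) (pt (code x)) x by [].
  apply: (le_lt_trans (dyadic_cube_dist Qx (dyadic_cube_refl _ _))).
  by rewrite ltr_pM2r ?side_gt0// ltr_nat.
move=> alpha alpha_gt0 alpha_lt1.
pose Q i := dyadic_cube (lev (pt i)) (pt i).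
pose g y := (\int[lebesgue_measure_rV d]_(z in ~` U) frac_kernel alpha (y, z))%E.
have mg : measurable_fun setT g.
  by apply: measurable_kernel_integral; exact: measurableC.
have g0 y : (0 <= g y)%E by exact: kernel_integral_ge0.
have tQ : trivIset I (fun i => U `&` Q i).
  move=> i j Ii Ij [v [[_ Qi] [_ Qj]]].
  have [Ui <-] := ptP _ Ii; have [Uj <-] := ptP _ Ij.
  have lij : lev (pt i) = lev (pt j).
    have Si := levP _ Ui; have Sj := levP _ Uj.
    have [ij|/ltW ji] := leP (lev (pt i)) (lev (pt j)).
      exact: stopping_level_le Si Qi Sj Qj ij.
    exact/esym/(stopping_level_le Sj Qj Si Qi ji).
  rewrite /code lij; congr (pickle (_, _)).
  by rewrite -Qj -lij Qi.
have a1 : 0 < 1 - alpha by rewrite subr_gt0.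
have K0 : 0 <= C * alpha * (1 - alpha) by apply: mulr_ge0; [apply: mulr_ge0|]; exact: ltW.
set c : R := C * alpha * (1 - alpha) in K0 *.
have mQU i : measurable (U `&` Q i).
  exact: (measurableI _ _ mU (measurable_dyadic_cube _ _)).
have cg (D : set 'rV[R]_d) : measurable D ->
    (\int[lebesgue_measure_rV d]_(y in D) (c%:E * g y) =
     c%:E * \int[lebesgue_measure_rV d]_(y in D) g y)%E.
  move=> mD; apply: ge0_integralZl_EFin => //; exact: measurable_funTS.
(* [esum_integral_le] compares integrals, so the constant is moved inside them. *)
apply: (@le_trans _ _ (\esum_(i in I)
    \int[lebesgue_measure_rV d]_(y in U `&` Q i) (c%:E * g y))%E).
  apply: le_esum => i Ii; have [Ui _] := ptP _ Ii; rewrite cg//.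
  have key := stopping_cube_energy_ge d_gt0 mU alpha_gt0 alpha_lt1 (levP _ Ui).
  have s0 := side_gt0 (R := R) (lev (pt i)).
  apply: (@le_trans _ _ (C%:E * (kappa * side (lev (pt i)) `^ (d%:R - alpha))%:E)%E).
    rewrite -EFinM lee_fin mulrA /C mulfVK ?gt_eqF// /r powRM ?ler0n ?(ltW s0)//.
    rewrite ler_wpM2r ?powR_ge0// -powR_mulrn ?ler0n// ler_powR ?ler1n//.
    by rewrite gerBl ltW.
  have -> : (c%:E = C%:E * (alpha * (1 - alpha))%:E)%E by rewrite -EFinM /c mulrA.
  rewrite -muleA; apply: lee_wpmul2l; first by rewrite lee_fin ltW.
  exact: key.
have cg0 y : (0 <= c%:E * g y)%E by rewrite mule_ge0// lee_fin.
have mcg : measurable_fun setT (fun y => c%:E * g y)%E by exact: measurable_funeM.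
apply: (le_trans (esum_integral_le (lebesgue_measure_rV d) mU mcg cg0
  (fun i _ => mQU i) (fun i _ => @subIsetl _ _ _) tQ)).
rewrite cg//; apply: lee_wpmul2l; first by rewrite lee_fin.
(* The factor 2 in the fractional perimeter is given away. *)
rewrite -[leLHS]mul1e; apply: lee_wpmul2r; last by rewrite lee_fin ler1n.
by apply: integral_ge0 => y _; exact: g0.
Qed.
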